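(* Let $(\mathcal{C},\mathcal{T})$ be a superspace site and let $F:\mathcal{C}^{\mathrm{op}}\to \mathrm{(Set)}$ be a functor. Then $F$ is representable if and only if both of the following hold: (1) $F$ is a sheaf for $(\mathcal{C},\mathcal{T})$; (2) $F$ has an open covering by representable functors $\{f_i:U_i\to F\}_{i\in I}$.
   Context: Grothendieck topology. A Grothendieck topology $\mathcal{T}$ on a category $\mathcal{C}$ assigns to each object $U$ a collection $\mathrm{Cov}(U)$ of families of morphisms with target $U$, called coverings of $U$, such that: (i) if $V\to U$ is an isomorphism, then $\{V\to U\}\in\mathrm{Cov}(U)$; (ii) if $V\to U$ is an arrow and $\{U_i\to U\}_{i\in I}\in\mathrm{Cov}(U)$, then the fibered products $U_i\times_U V$ exist and $\{U_i\times_U V\to V\}_{i\in I}\in\mathrm{Cov}(V)$; (iii) if $\{U_i\to U\}_{i\in I}\in \mathrm{Cov}(U)$ and $\{V_{ij}\to U_i\}_{j\in J_i}\in\mathrm{Cov}(U_i)$ for each $i$, then the family of composites $\{V_{ij}\to U_i\to U\}_{i\in I,j\in J_i}$ is in $\mathrm{Cov}(U)$. The pair $(\mathcal{C},\mathcal{T})$ is a site. One writes $\mathcal{U}\in\mathcal{T}$ to say that the family $\mathcal{U}$ is a covering for $\mathcal{T}$. Sheaves. A functor $F:\mathcal{C}^{\mathrm{op}}\to\mathrm{(Set)}$ is a sheaf for $(\mathcal{C},\mathcal{T})$ if for every covering $\{U_i\to U\}_{i\in I}$ in $\mathcal{T}$ the map $F(U)\to\prod_{i}F(U_i)$ induced by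 restrictions is injective with image the set of families $(\xi_i)_{i\in I}$ such that $\mathrm{pr}_1^*(\xi_i)=\mathrm{pr}_2^*(\xi_j)$ in $F(U_i\times_U U_j)$ for all $i,j\in I$, where $\mathrm{pr}_1^*=F(\mathrm{pr}_1)$, $\mathrm{pr}_2^*=F(\mathrm{pr}_2)$. Superspaces. A superspace $X=(|X|,\mathcal{O}_X)$ is a topological space $|X|$ with a sheaf $\mathcal{O}_X$ of commutative super rings ($\mathbb{Z}/2$-graded, supercommutative) whose stalks $\mathcal{O}_{X,p}$ are local super rings. A morphism $X\to Y$ is a pair $(|f|,f^* )$ with $|f|:|X|\to|Y|$ continuous and $f^*:\mathcal{O}_Y\to f_*\mathcal{O}_X$ a map of sheaves of super rings inducing local morphisms $\mathcal{O}_{Y,|f|(p)}\to\mathcal{O}_{X,p}$ for all $p\in |X|$. The resulting category is denoted $\mathrm{(SSpaces)}$. For $|U|\subseteq|X|$ open, $X_U=(|U|,\mathcal{O}_X|_{|U|})$, with canonical morphism $j_{X|U}:X_U\to X$. A morphism $\varphi:Y\to X$ is an open embedding if $\varphi=j_{X|U}\circ\phi$ for some open $|U|\subseteq |X|$ and some isomorphism $\phi:Y\to X_U$; one then writes $\varphi(Y)=X_U$. Gluing data. A gluing datum $((U_i)_{i\in I},(U_{ij})_{i,j\in I},(\phi_{ij})_{i,j\in I})$ of superspaces consists of superspaces $U_i$, open subsuperspaces $U_{ij}\subseteq U_i$ with $U_{ii}=U_i$, and isomorphisms $\phi_{ji}:U_{ij}\to U_{ji}$ satisfying the cocycle condition $\phi_{ki}=\phi_{kj}\circ\phi_{ji}$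 on $U_{ij}\cap U_{ik}$ (in particular the composite is defined there). To a gluing datum corresponds a superspace $X$ with open embeddings $\phi_i:U_i\to X$, unique up to isomorphism, such that $X=\bigcup_i\phi_i(U_i)$, $\phi_i=\phi_j\circ\phi_{ji}$ on $U_{ij}$, and $\phi_i(U_{ij})=\phi_j(U_{ji})=\phi_i(U_i)\cap\phi_j(U_j)$ for all $i,j$. Superspace sites. A site $(\mathcal{C},\mathcal{T})$ is a superspace site if: - $\mathcal{C}$ is a full subcategory of $\mathrm{(SSpaces)}$; - $\mathcal{T}$ is a topology such that, for every $\{f_i:U_i\to X\}_{i\in I}\in\mathcal{T}$, the arrows $f_i$ are open embeddings and $\bigcup_{i\in I}|f_i|(|U_i|)=|X|$; - for every object $X$ of $\mathcal{C}$ and every open subset $|U|\subseteq|X|$, $X_U$ is an object of $\mathcal{C}$; - for every gluing datum in $\mathcal{C}$, the corresponding superspace $X$ is an object of $\mathcal{C}$. Representability and open coverings. For $X\in\mathrm{Ob}(\mathcal{C})$, $h_X:\mathcal{C}^{\mathrm{op}}\to\mathrm{(Set)}$ is the functor $h_X(T)=\mathrm{Hom}(T,X)$, $h_X(\phi)(f)=f\circ\phi$. A functor $F:\mathcal{C}^{\mathrm{op}}\to\mathrm{(Set)}$ is representable if $F\cong h_X$ for some $X\in\mathrm{Ob}(\mathcal{C})$. A natural transformation $f:F\to G$ of functors $\mathcal{C}^{\mathrm{op}}\to\mathrm{(Set)}$ is representable if for every $X\in\mathrm{Ob}(\mathcal{C})$ and every natural transformation $g:h_X\to G$, the functor $F\times_G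 h_X$ is representable. Given $f:U\to G$, one says that $U$ is an open subfunctor of $G$ if $f$ is a monomorphism, $f$ is representable, and for every $X\in\mathrm{Ob}(\mathcal{C})$ and every $g:h_X\to G$, the second projection $\mathrm{pr}_2:U\times_G h_X\to h_X$ corresponds, via Yoneda's Lemma, to an open embedding $\mathrm{pr}_2^{\mathrm{Yon}}:Z\to X$, where $h_Z\cong U\times_G h_X$. A family $\{f_i:U_i\to F\}_{i\in I}$ of open subfunctors is an open covering of $F$ if for every $X\in\mathrm{Ob}(\mathcal{C})$ and every $g:h_X\to F$, the family $\{(\mathrm{pr}_2)_i^{\mathrm{Yon}}:X_i\to X\}_{i\in I}$, where $h_{X_i}\cong U_i\times_F h_X$, is a covering of $X$ in the site $(\mathcal{C},\mathcal{T})$. If moreover all $U_i$ are representable functors, $F$ is said to have an open covering by representable functors.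
   Formalization: The coverings of a superspace site are taken to be all jointly surjective families of open embeddings in C, not just some; otherwise the claim fails, e.g. when only isomorphisms cover, the empty functor is a sheaf covered by the empty family but is not representable. *)

(* Defs.v *)
From HB Require Import structures.
From mathcomp Require Import all_boot all_order all_algebra.
From mathcomp Require Import generic_quotient.
From mathcomp Require Import boolp classical_sets functions.
From mathcomp Require Import topology_structure initial_topology subtype_topology.

Set Implicit Arguments.
Unset Strict Implicit.
Unset Printing Implicit Defensive.

Import GRing.Theory.
Local Open Scope quotient_scope.
Local Open Scope classical_set_scope.
Local Open Scope ring_scope.

(* The parity [b : bool] is [false] for even and [true] for odd.  The carrier
   is a [pzRingType], so that the zero ring (sections over the empty set) is
   allowed. *)
Record superRing := SuperRing {
  sr_ring :> pzRingType;
  homog : bool -> set sr_ring;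
  homog0 : forall b, homog b 0;
  homogB : forall b x y, homog b x -> homog b y -> homog b (x - y);
  homog1 : homog false 1;
  homogM : forall b c x y, homog b x -> homog c y -> homog (b (+) c) (x * y);
  homog_sum : forall x, exists x0 x1,
    [/\ homog false x0, homog true x1 & x = x0 + x1];
  homog_direct : forall x, homog false x -> homog true x -> x = 0;
  supercomm : forall b c x y, homog b x -> homog c y ->
    x * y = (-1) ^+ (b && c) * (y * x)
}.
Arguments homog {s} _ _.

Definition srmorph (A B : superRing) (f : A -> B) : Prop :=
  [/\ GRing.zmod_morphism f, GRing.monoid_morphism f &
      forall b x, homog b x -> homog b (f x)].

(* By convention ideals, hence maximal ideals, of a super ring are homogeneous. *)
Record is_ideal (A : superRing) (I : set A) : Prop := IsIdeal {
  ideal0 : I 0;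
  idealD : forall x y, I x -> I y -> I (x + y);
  idealMl : forall a x, I x -> I (a * x);
  idealMr : forall a x, I x -> I (x * a);
  ideal_homog : forall x0 x1, homog false x0 -> homog true x1 ->
    I (x0 + x1) -> I x0 /\ I x1
}.

Definition is_maximal (A : superRing) (I : set A) : Prop :=
  [/\ is_ideal I, ~ I 1 &
      forall J : set A, is_ideal J -> ~ J 1 -> I `<=` J -> J = I].

Definition is_local (A : superRing) : Prop := exists! I : set A, is_maximal I.

Definition local_morph (A B : superRing) (f : A -> B) : Prop :=
  forall (I : set A) (J : set B), is_maximal I -> is_maximal J ->
    f @` I `<=` J.

Section SrmorphTheory.
Variables (A B : superRing) (f : A -> B).
Hypothesis fM : srmorph f.

Lemma srmB x y : f (x - y) = f x - f y. Proof. by case: fM => h _ _; apply: h. Qed.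
Lemma srm0 : f 0 = 0. Proof. by rewrite -(subrr 0) srmB subrr. Qed.
Lemma srmN x : f (- x) = - f x. Proof. by rewrite -sub0r srmB srm0 sub0r. Qed.
Lemma srmD x y : f (x + y) = f x + f y.
Proof. by rewrite -[y]opprK srmB !srmN !opprK. Qed.
Lemma srmM x y : f (x * y) = f x * f y. Proof. by case: fM => _ [_ h] _; apply: h. Qed.
Lemma srm1 : f 1 = 1. Proof. by case: fM => _ [h _] _; apply: h. Qed.
Lemma srmH b x : homog b x -> homog b (f x).
Proof. by case: fM => _ _; apply. Qed.

Lemma ideal_preim (J : set B) : is_ideal J -> is_ideal (f @^-1` J).
Proof.
move=> iJ; split => /=.
- by rewrite /preimage /= srm0; apply: ideal0.
- by move=> x y; rewrite /preimage /= srmD; apply: idealD.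
- by move=> a x; rewrite /preimage /= srmM; apply: idealMl.
- by move=> a x; rewrite /preimage /= srmM; apply: idealMr.
- move=> x0 x1 h0 h1; rewrite /preimage /= srmD.
  by apply: ideal_homog => //; apply: srmH.
Qed.

Hypotheses (fI : injective f) (fS : forall y, exists x, f x = y).

Lemma srmH_iso b x : homog b (f x) -> homog b x.
Proof.
have [x0 [x1 [h0 h1 ->]]] := homog_sum x; rewrite srmD => h.
case: b h => h.
- have e0 : x0 = 0.
    apply: fI; rewrite srm0; apply: homog_direct; first exact: srmH.
    rewrite -[f x0](addrK (f x1)); apply: homogB => //; exact: srmH.
  by rewrite e0 add0r.
- have e1 : x1 = 0.
    apply: fI; rewrite srm0; apply: homog_direct; last exact: srmH.
    rewrite -[f x1](addKr (f x0)) addrC; apply: homogB => //; exact: srmH.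
  by rewrite e1 addr0.
Qed.

Lemma ideal_im (I : set A) : is_ideal I -> is_ideal (f @` I).
Proof.
move=> iI; split => /=.
- by exists 0; [exact: ideal0 | exact: srm0].
- by move=> _ _ [x Ix <-] [y Iy <-]; exists (x + y); [exact: idealD | exact: srmD].
- move=> b _ [x Ix <-]; have [a <-] := fS b.
  by exists (a * x); [exact: idealMl | exact: srmM].
- move=> b _ [x Ix <-]; have [a <-] := fS b.
  by exists (x * a); [exact: idealMr | exact: srmM].
- move=> y0 y1; have [x0 <-] := fS y0; have [x1 <-] := fS y1.
  move=> /srmH_iso h0 /srmH_iso h1 [x Ix]; rewrite -srmD => /fI ex.
  have [I0 I1] : I x0 /\ I x1 by apply: ideal_homog => //; rewrite -ex.
  by split; [exists x0 | exists x1].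
Qed.

Lemma im1 (I : set A) : (f @` I) 1 <-> I 1.
Proof.
split=> [[x Ix]|I1]; last by exists 1 => //; exact: srm1.
by rewrite -srm1 => /fI <-.
Qed.

Lemma maximal_im (I : set A) : is_maximal I -> is_maximal (f @` I).
Proof.
move=> [iI nI mI]; split; [exact: ideal_im | by rewrite im1 |].
move=> J iJ nJ sJ; have e : f @^-1` J = I.
  apply: mI; [exact: ideal_preim | by rewrite /preimage /= srm1 |].
  by move=> x Ix; apply: sJ; exists x.
rewrite -e; apply/seteqP; split=> [y|_ [x Jx <-] //].
by have [x <-] := fS y => Jx; exists x.
Qed.

Lemma maximal_preim (J : set B) : is_maximal J -> is_maximal (f @^-1` J).
Proof.
move=> [iJ nJ mJ]; split; [exact: ideal_preim | by rewrite /preimage /= srm1 |].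
move=> I iI nI sI; have e : f @` I = J.
  apply: mJ; [exact: ideal_im | by rewrite im1 |].
  by move=> y; have [x <-] := fS y => Jx; exists x => //; apply: sI.
rewrite -e; apply/seteqP; split=> [x Ix|x [x' Ix' /fI <-] //].
by exists x.
Qed.

Lemma local_iso : is_local A -> is_local B.
Proof.
move=> [I [mI uI]]; exists (f @` I); split; first exact: maximal_im.
move=> J mJ; rewrite (uI _ (maximal_preim mJ)).
apply/seteqP; split=> [_ [x Jx <-] //|y].
by have [x <-] := fS y => Jx; exists x.
Qed.

Lemma local_morph_iso : is_local A -> local_morph f.
Proof.
move=> [I0 [_ uI]] I J mI mJ _ [x Ix <-].
have := maximal_preim mJ; move=> /uI e0; move: Ix.
by rewrite -(uI _ mI) e0.
Qed.

End SrmorphTheory.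

Lemma srmorph_id (A : superRing) : srmorph (@id A).
Proof. by split. Qed.

Lemma srmorph_comp (A B C : superRing) (f : A -> B) (g : B -> C) :
  srmorph f -> srmorph g -> srmorph (g \o f).
Proof.
move=> fM gM; split=> [x y /=||b x /= h]; first by rewrite !srmB.
- by split=> [|x y] /=; rewrite ?srm1 ?srmM.
- by apply: srmH => //; apply: srmH.
Qed.

(* Primitive projections make the preimage of an open set under the identity
   and under composites convertible to what one expects. *)
#[projections(primitive)]
Record opens (X : topologicalType) := Opens {
  oset :> set X;
  oset_open : open oset
}.

Definition opensI (X : topologicalType) (U V : opens X) : opens X :=
  Opens (openI (oset_open U) (oset_open V)).

Lemma opensIl (X : topologicalType) (U V : opens X) : opensI U V `<=` U.
Proof. by move=> x []. Qed.

Lemma opensIr (X : topologicalType) (U V : opens X) : opensI U V `<=` V.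
Proof. by move=> x []. Qed.

Record spresheaf (X : topologicalType) := SPresheaf {
  sections :> opens X -> superRing;
  res : forall U V : opens X, V `<=` U -> sections U -> sections V;
  res_morph : forall (U V : opens X) (h : V `<=` U), srmorph (res h);
  res_id : forall (U : opens X) (h : U `<=` U) s, res h s = s;
  res_comp : forall (U V W : opens X) (h : V `<=` U) (k : W `<=` V) (l : W `<=` U) s,
    res k (res h s) = res l s
}.
Arguments res {X} _ {U V} _ _.

Definition is_ssheaf (X : topologicalType) (O : spresheaf X) : Prop :=
  forall (I : Type) (U : opens X) (V : I -> opens X) (h : forall i, V i `<=` U),
    U `<=` \bigcup_i V i ->
  forall s : forall i, O (V i),
    (forall i j, res O (@opensIl X (V i) (V j)) (s i) =
                 res O (@opensIr X (V i) (V j)) (s j)) ->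
  exists! t : O U, forall i, res O (h i) t = s i.

Section Stalk.
Variables (X : topologicalType) (O : spresheaf X) (p : X).

Record pregerm := Pregerm {
  pg_open : opens X;
  pg_mem : oset pg_open p;
  pg_sec : O pg_open
}.

HB.instance Definition _ := gen_eqMixin pregerm.
HB.instance Definition _ := gen_choiceMixin pregerm.

Definition same_germ (a b : pregerm) : Prop :=
  exists (W : opens X) (h : W `<=` pg_open a) (k : W `<=` pg_open b),
    oset W p /\ res O h (pg_sec a) = res O k (pg_sec b).

Lemma same_germ_refl a : same_germ a a.
Proof. by exists (pg_open a), (@subset_refl _ _), (@subset_refl _ _); split=> //; exact: pg_mem. Qed.

Lemma same_germ_sym a b : same_germ a b -> same_germ b a.
Proof. by move=> [W [h [k [Wp e]]]]; exists W, k, h. Qed.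

Lemma same_germ_trans a b c : same_germ a b -> same_germ b c -> same_germ a c.
Proof.
move=> [W [h [k [Wp e]]]] [W' [h' [k' [Wp' e']]]].
exists (opensI W W'), (subset_trans (@opensIl _ W W') h),
  (subset_trans (@opensIr _ W W') k'); split; first by [].
rewrite -(res_comp h (@opensIl _ W W')) e -(res_comp k' (@opensIr _ W W')) -e'.
have l := subset_trans (@opensIl _ W W') k.
by rewrite !(res_comp _ _ l).
Qed.

Definition germ_rel (a b : pregerm) : bool := `[< same_germ a b >].

Lemma germ_rel_refl : reflexive germ_rel.
Proof. by move=> a; apply/asboolP/same_germ_refl. Qed.
Lemma germ_rel_sym : symmetric germ_rel.
Proof. by move=> a b; apply/asboolP/asboolP; apply: same_germ_sym. Qed.
Lemma germ_rel_trans : transitive germ_rel.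
Proof.
by move=> b a c /asboolP h /asboolP k; apply/asboolP; apply: same_germ_trans h k.
Qed.

Definition germ_equiv := EquivRel germ_rel germ_rel_refl germ_rel_sym germ_rel_trans.

Definition stalk := {eq_quot germ_equiv}.
HB.instance Definition _ := Choice.on stalk.

Definition germ (U : opens X) (Up : oset U p) (s : O U) : stalk :=
  \pi_stalk (Pregerm Up s).

Lemma germ_eq (U V : opens X) (Up : oset U p) (Vp : oset V p) (s : O U) (t : O V) :
  germ Up s = germ Vp t <-> same_germ (Pregerm Up s) (Pregerm Vp t).
Proof. by split=> [/eqmodP /asboolP|h]; [|apply/eqmodP/asboolP]. Qed.

Lemma germ_res (U V : opens X) (Up : oset U p) (Vp : oset V p) (h : V `<=` U) (s : O U) :
  germ Vp (res O h s) = germ Up s.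
Proof.
apply/germ_eq; exists V, (@subset_refl _ _), h; split=> //=.
by rewrite res_id.
Qed.

Lemma germP (a : stalk) : exists (U : opens X) (Up : oset U p) (s : O U), a = germ Up s.
Proof.
by elim/quotW: a => -[U Up s]; exists U, Up, s.
Qed.

Lemma germP2 (a b : stalk) : exists (U : opens X) (Up : oset U p) (s t : O U),
  a = germ Up s /\ b = germ Up t.
Proof.
have [U [Up [s ->]]] := germP a; have [V [Vp [t ->]]] := germP b.
have Wp : oset (opensI U V) p by [].
exists (opensI U V), Wp, (res O (@opensIl _ U V) s), (res O (@opensIr _ U V) t).
by rewrite !germ_res.
Qed.

Lemma germP3 (a b c : stalk) : exists (U : opens X) (Up : oset U p) (s t u : O U),
  [/\ a = germ Up s, b = germ Up t & c = germ Up u].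
Proof.
have [U [Up [s [t [-> ->]]]]] := germP2 a b; have [V [Vp [u ->]]] := germP c.
have Wp : oset (opensI U V) p by [].
exists (opensI U V), Wp, (res O (@opensIl _ U V) s), (res O (@opensIl _ U V) t),
  (res O (@opensIr _ U V) u).
by rewrite !germ_res.
Qed.

Definition stalk_op1 (op : forall U, O U -> O U) (a : stalk) : stalk :=
  germ (pg_mem (repr a)) (op _ (pg_sec (repr a))).

Definition stalk_op2 (op : forall U, O U -> O U -> O U) (a b : stalk) : stalk :=
  let W := opensI (pg_open (repr a)) (pg_open (repr b)) in
  let Wp : oset W p := conj (pg_mem (repr a)) (pg_mem (repr b)) in
  germ Wp (op W (res O (@opensIl _ _ _) (pg_sec (repr a)))
                (res O (@opensIr _ _ _) (pg_sec (repr b)))).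

Lemma same_repr (U : opens X) (Up : oset U p) (s : O U) :
  same_germ (repr (germ Up s)) (Pregerm Up s).
Proof.
have : germ Up s = \pi_stalk (repr (germ Up s)) by rewrite reprK.
by move/esym/eqmodP/asboolP.
Qed.

Lemma stalk_op1E (op : forall U, O U -> O U) :
  (forall (U V : opens X) (h : V `<=` U) s, res O h (op U s) = op V (res O h s)) ->
  forall (U : opens X) (Up : oset U p) s, stalk_op1 op (germ Up s) = germ Up (op U s).
Proof.
move=> nat U Up s; apply/germ_eq => /=.
have [W [h [k [Wp e]]]] := same_repr Up s.
by exists W, h, k; split=> //=; rewrite !nat e.
Qed.

Lemma stalk_op2E (op : forall U, O U -> O U -> O U) :
  (forall (U V : opens X) (h : V `<=` U) s t,
     res O h (op U s t) = op V (res O h s) (res O h t)) ->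
  forall (U : opens X) (Up : oset U p) s t,
    stalk_op2 op (germ Up s) (germ Up t) = germ Up (op U s t).
Proof.
move=> nat U Up s t; apply/germ_eq => /=.
have [W [h [k [Wp e]]]] := same_repr Up s.
have [W' [h' [k' [Wp' e']]]] := same_repr Up t.
set V := opensI _ _; set T := opensI W W'.
have TV : T `<=` V by move=> x [Wx Wx']; split; [exact (h _ Wx) | exact (h' _ Wx')].
have TU : T `<=` U by move=> x [Wx _]; exact (k _ Wx).
exists T, TV, TU; split; first by [].
have lW := @opensIl _ W W'; have lW' := @opensIr _ W W'.
rewrite /= !nat (res_comp _ TV (subset_trans lW h)).
rewrite (res_comp _ TV (subset_trans lW' h')).
rewrite -(res_comp h lW) -(res_comp h' lW') e e' /=.
by rewrite !(res_comp _ _ TU).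
Qed.

Lemma res_opp (U V : opens X) (h : V `<=` U) (s : O U) :
  res O h (- s) = - res O h s.
Proof. by rewrite srmN //; apply: res_morph. Qed.
Lemma res_add (U V : opens X) (h : V `<=` U) (s t : O U) :
  res O h (s + t) = res O h s + res O h t.
Proof. by rewrite srmD //; apply: res_morph. Qed.
Lemma res_mul (U V : opens X) (h : V `<=` U) (s t : O U) :
  res O h (s * t) = res O h s * res O h t.
Proof. by rewrite srmM //; apply: res_morph. Qed.

Definition stalk_top : opens X := Opens openT.
Definition stalk_cst (c : O stalk_top) : stalk := germ (I : oset stalk_top p) c.
Definition stalk_zero := stalk_cst 0.
Definition stalk_one := stalk_cst 1.
Definition stalk_opp := stalk_op1 (fun U (s : O U) => - s).
Definition stalk_add := stalk_op2 (fun U (s t : O U) => s + t).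
Definition stalk_mul := stalk_op2 (fun U (s t : O U) => s * t).

Lemma germ0 (U : opens X) (Up : oset U p) : germ Up 0 = stalk_zero.
Proof.
have h : U `<=` stalk_top by [].
rewrite /stalk_zero /stalk_cst -(@germ_res _ _ _ Up h).
by rewrite srm0 //; apply: res_morph.
Qed.
Lemma germ1 (U : opens X) (Up : oset U p) : germ Up 1 = stalk_one.
Proof.
have h : U `<=` stalk_top by [].
rewrite /stalk_one /stalk_cst -(@germ_res _ _ _ Up h).
by rewrite srm1 //; apply: res_morph.
Qed.
Lemma stalk_oppE (U : opens X) (Up : oset U p) s : stalk_opp (germ Up s) = germ Up (- s).
Proof. by rewrite [LHS]stalk_op1E //; exact: res_opp. Qed.
Lemma stalk_addE (U : opens X) (Up : oset U p) s t :
  stalk_add (germ Up s) (germ Up t) = germ Up (s + t).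
Proof. by rewrite [LHS]stalk_op2E //; exact: res_add. Qed.
Lemma stalk_mulE (U : opens X) (Up : oset U p) s t :
  stalk_mul (germ Up s) (germ Up t) = germ Up (s * t).
Proof. by rewrite [LHS]stalk_op2E //; exact: res_mul. Qed.

Fact stalk_addA : associative stalk_add.
Proof.
move=> a b c; have [U [Up [s [t [u [-> -> ->]]]]]] := germP3 a b c.
by rewrite !stalk_addE addrA.
Qed.
Fact stalk_addC : commutative stalk_add.
Proof.
move=> a b; have [U [Up [s [t [-> ->]]]]] := germP2 a b.
by rewrite !stalk_addE addrC.
Qed.
Fact stalk_add0 : left_id stalk_zero stalk_add.
Proof.
by move=> a; have [U [Up [s ->]]] := germP a; rewrite -(germ0 Up) stalk_addE add0r.
Qed.
Fact stalk_addN : left_inverse stalk_zero stalk_opp stalk_add.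
Proof.
move=> a; have [U [Up [s ->]]] := germP a.
by rewrite stalk_oppE stalk_addE addNr germ0.
Qed.

HB.instance Definition _ :=
  GRing.isZmodule.Build stalk stalk_addA stalk_addC stalk_add0 stalk_addN.

Fact stalk_mulA : associative stalk_mul.
Proof.
move=> a b c; have [U [Up [s [t [u [-> -> ->]]]]]] := germP3 a b c.
by rewrite !stalk_mulE mulrA.
Qed.
Fact stalk_mul1 : left_id stalk_one stalk_mul.
Proof.
by move=> a; have [U [Up [s ->]]] := germP a; rewrite -(germ1 Up) stalk_mulE mul1r.
Qed.
Fact stalk_mulr1 : right_id stalk_one stalk_mul.
Proof.
by move=> a; have [U [Up [s ->]]] := germP a; rewrite -(germ1 Up) stalk_mulE mulr1.
Qed.
Fact stalk_mulDl : left_distributive stalk_mul +%R.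
Proof.
move=> a b c; have [U [Up [s [t [u [-> -> ->]]]]]] := germP3 a b c.
by rewrite /+%R /= !stalk_addE !stalk_mulE stalk_addE mulrDl.
Qed.
Fact stalk_mulDr : right_distributive stalk_mul +%R.
Proof.
move=> a b c; have [U [Up [s [t [u [-> -> ->]]]]]] := germP3 a b c.
by rewrite /+%R /= !stalk_addE !stalk_mulE stalk_addE mulrDr.
Qed.

HB.instance Definition _ := GRing.Zmodule_isPzRing.Build stalk
  stalk_mulA stalk_mul1 stalk_mulr1 stalk_mulDl stalk_mulDr.

Lemma germZ (U : opens X) (Up : oset U p) : germ Up 0 = 0 :> stalk.
Proof. exact: germ0. Qed.
Lemma germU (U : opens X) (Up : oset U p) : germ Up 1 = 1 :> stalk.
Proof. exact: germ1. Qed.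
Lemma germN (U : opens X) (Up : oset U p) s : germ Up (- s) = - germ Up s.
Proof. by rewrite -stalk_oppE. Qed.
Lemma germD (U : opens X) (Up : oset U p) s t : germ Up (s + t) = germ Up s + germ Up t.
Proof. by rewrite -stalk_addE. Qed.
Lemma germB (U : opens X) (Up : oset U p) s t : germ Up (s - t) = germ Up s - germ Up t.
Proof. by rewrite germD germN. Qed.
Lemma germM (U : opens X) (Up : oset U p) s t : germ Up (s * t) = germ Up s * germ Up t.
Proof. by rewrite -stalk_mulE. Qed.

Definition stalk_homog (b : bool) : set stalk :=
  [set a | exists (U : opens X) (Up : oset U p) (s : O U), homog b s /\ a = germ Up s].

Lemma stalk_homogP2 b c (x y : stalk) : stalk_homog b x -> stalk_homog c y ->
  exists (U : opens X) (Up : oset U p) (s t : O U),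
    [/\ homog b s, homog c t, x = germ Up s & y = germ Up t].
Proof.
move=> [U [Up [s [hs ->]]]] [V [Vp [t [ht ->]]]].
have Wp : oset (opensI U V) p by [].
exists (opensI U V), Wp, (res O (@opensIl _ U V) s), (res O (@opensIr _ U V) t).
by rewrite !germ_res; split=> //; apply: srmH => //; apply: res_morph.
Qed.

Fact stalk_homog0 b : stalk_homog b 0.
Proof.
exists stalk_top, I, 0; split; first exact: homog0.
by rewrite germZ.
Qed.
Fact stalk_homogB b x y : stalk_homog b x -> stalk_homog b y -> stalk_homog b (x - y).
Proof.
move=> hx hy; have [U [Up [s [t [hs ht -> ->]]]]] := stalk_homogP2 hx hy.
by exists U, Up, (s - t); rewrite germB; split=> //; apply: homogB.
Qed.
Fact stalk_homog1 : stalk_homog false 1.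
Proof.
exists stalk_top, I, 1; split; first exact: homog1.
by rewrite germU.
Qed.
Fact stalk_homogM b c x y :
  stalk_homog b x -> stalk_homog c y -> stalk_homog (b (+) c) (x * y).
Proof.
move=> hx hy; have [U [Up [s [t [hs ht -> ->]]]]] := stalk_homogP2 hx hy.
by exists U, Up, (s * t); rewrite germM; split=> //; apply: homogM.
Qed.
Fact stalk_homog_sum x : exists x0 x1,
  [/\ stalk_homog false x0, stalk_homog true x1 & x = x0 + x1].
Proof.
have [U [Up [s ->]]] := germP x; have [s0 [s1 [h0 h1 ->]]] := homog_sum s.
by exists (germ Up s0), (germ Up s1); rewrite germD; split=> //;
  [exists U, Up, s0 | exists U, Up, s1].
Qed.
Fact stalk_homog_direct x : stalk_homog false x -> stalk_homog true x -> x = 0.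
Proof.
move=> hx hy; have [U [Up [s [t [hs ht -> /germ_eq]]]]] := stalk_homogP2 hx hy.
move=> [W [h [k [Wp /= e]]]].
rewrite -(germ_res Up Wp h) (_ : res O h s = 0) ?germZ //.
apply: homog_direct; first by apply: srmH => //; apply: res_morph.
by rewrite e; apply: srmH => //; apply: res_morph.
Qed.
Fact stalk_supercomm b c x y : stalk_homog b x -> stalk_homog c y ->
  x * y = (-1) ^+ (b && c) * (y * x).
Proof.
move=> hx hy; have [U [Up [s [t [hs ht -> ->]]]]] := stalk_homogP2 hx hy.
rewrite -!germM (supercomm hs ht); case: (b && c) => /=.
  by rewrite !expr1 !mulN1r germN.
by rewrite !expr0 !mul1r.
Qed.

Definition stalk_sr : superRing := SuperRing stalk_homog0 stalk_homogB
  stalk_homog1 stalk_homogM stalk_homog_sum stalk_homog_direct stalk_supercomm.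

End Stalk.

(* Continuity is phrased with preimages of open sets so that taking preimages
   commutes with composition up to conversion. *)
Definition preim (X Y : topologicalType) (f : X -> Y)
  (fO : forall V : set Y, open V -> open (f @^-1` V)) (V : opens Y) : opens X :=
  Opens (fO V (oset_open V)).

Record smap (X Y : topologicalType) (OX : spresheaf X) (OY : spresheaf Y) := SMap {
  base :> X -> Y;
  base_open : forall V : set Y, open V -> open (base @^-1` V);
  comap : forall V : opens Y, OY V -> OX (preim base_open V);
  comap_morph : forall V, srmorph (@comap V);
  comap_res : forall (V W : opens Y) (h : W `<=` V)
    (k : preim base_open W `<=` preim base_open V) (s : OY V),
    comap (res OY h s) = res OX k (comap s)
}.
Arguments comap {X Y OX OY} _ {V} _.

Section StalkMap.
Variables (X Y : topologicalType) (OX : spresheaf X) (OY : spresheaf Y).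
Variables (f : smap OX OY) (p : X).

Definition spreim (V : opens Y) : opens X := preim (@base_open _ _ _ _ f) V.

Definition stalk_map (a : stalk_sr OY (f p)) : stalk_sr OX p :=
  @germ X OX p (spreim (pg_open (repr a))) (pg_mem (repr a))
    (comap f (pg_sec (repr a))).

Lemma spreimS (V W : opens Y) : W `<=` V -> spreim W `<=` spreim V.
Proof. by move=> h x; apply: h. Qed.

Lemma stalk_mapE (V : opens Y) (Vp : oset V (f p)) (s : OY V) :
  stalk_map (germ Vp s) = @germ X OX p (spreim V) Vp (comap f s).
Proof.
apply/germ_eq; have [W [h [k [Wp e]]]] := same_repr Vp s.
exists (spreim W), (spreimS h), (spreimS k); split=> //=.
by rewrite -(comap_res h) -(comap_res k) e.
Qed.

Lemma stalk_map_morph : srmorph stalk_map.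
Proof.
split=> [a b||b a].
- have [V [Vp [s [t [-> ->]]]]] := germP2 a b.
  by rewrite -germB !stalk_mapE -germB srmB //; apply: comap_morph.
- split=> [|a b].
    rewrite -(germU OY (I : oset (stalk_top Y) (f p))) stalk_mapE -(germU OX (I : oset (spreim (stalk_top Y)) p)).
    by rewrite srm1 //; apply: comap_morph.
  have [V [Vp [s [t [-> ->]]]]] := germP2 a b.
  by rewrite -germM !stalk_mapE -germM srmM //; apply: comap_morph.
- move=> [V [Vp [s [hs ->]]]]; exists (spreim V), Vp, (comap f s); split.
    by apply: srmH => //; apply: comap_morph.
  by rewrite stalk_mapE.
Qed.

End StalkMap.

Lemma smap_eq (X Y : topologicalType) (OX : spresheaf X) (OY : spresheaf Y)
  (b : X -> Y) bo c m1 m2 r1 r2 :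
  @SMap X Y OX OY b bo c m1 r1 = @SMap X Y OX OY b bo c m2 r2.
Proof. by rewrite (Prop_irrelevance m1 m2) (Prop_irrelevance r1 r2). Qed.

Section SMapCat.
Variables (X Y Z : topologicalType).
Variables (OX : spresheaf X) (OY : spresheaf Y) (OZ : spresheaf Z).

Lemma smap_id_res (V W : opens X) (h k : W `<=` V) (s : OX V) :
  res OX h s = res OX k s.
Proof. by congr (res OX _ s); apply: Prop_irrelevance. Qed.

Definition smap_id : smap OX OX :=
  @SMap X X OX OX id (fun V oV => oV) (fun V s => s)
    (fun V => srmorph_id (OX V)) smap_id_res.

Variables (g : smap OY OZ) (f : smap OX OY).

Let comp_open (V : set Z) (oV : open V) : open ((fun x => g (f x)) @^-1` V) :=
  base_open f (base_open g oV).

Lemma smap_comp_morph (V : opens Z) :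
  srmorph (fun s : OZ V => comap f (comap g s)).
Proof. exact (srmorph_comp (comap_morph g V) (comap_morph f _)). Qed.

Lemma smap_comp_res (V W : opens Z) (h : W `<=` V)
  (k : preim comp_open W `<=` preim comp_open V) (s : OZ V) :
  comap f (comap g (res OZ h s)) = res OX k (comap f (comap g s)).
Proof.
rewrite (comap_res h (spreimS (f := g) h)).
exact (@comap_res _ _ _ _ f (spreim g V) (spreim g W) _ k _).
Qed.

Definition smap_comp : smap OX OZ :=
  @SMap X Z OX OZ (fun x => g (f x)) comp_open
    (fun V s => comap f (comap g s)) smap_comp_morph smap_comp_res.

End SMapCat.

Record superspace := Superspace {
  ss_top :> topologicalType;
  ss_sheaf : spresheaf ss_top;
  ss_sheafP : is_ssheaf ss_sheaf;
  ss_local : forall p : ss_top, is_local (stalk_sr ss_sheaf p)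
}.

Record sshom (X Y : superspace) := SSHom {
  ss_map :> smap (ss_sheaf X) (ss_sheaf Y);
  ss_map_local : forall p : X, local_morph (@stalk_map _ _ _ _ ss_map p)
}.

Lemma sshom_eq (X Y : superspace) (f g : sshom X Y) :
  ss_map f = ss_map g -> f = g.
Proof.
case: f g => f lf [g lg] /= e; subst g; congr SSHom; exact: Prop_irrelevance.
Qed.

Lemma stalk_map_id (X : topologicalType) (OX : spresheaf X) (p : X) a :
  stalk_map (f := smap_id OX) (p := p) a = a.
Proof. by have [V [Vp [s ->]]] := germP a; rewrite stalk_mapE. Qed.

Lemma stalk_map_comp (X Y Z : topologicalType) (OX : spresheaf X)
  (OY : spresheaf Y) (OZ : spresheaf Z) (g : smap OY OZ) (f : smap OX OY) (p : X) a :
  stalk_map (f := smap_comp g f) (p := p) a =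
  stalk_map (f := f) (stalk_map (f := g) (p := f p) a).
Proof.
have [V [Vp [s ->]]] := germP a.
rewrite [LHS]stalk_mapE [X in _ = stalk_map X]stalk_mapE.
by rewrite [RHS](@stalk_mapE _ _ _ _ f p (spreim g V) Vp).
Qed.

Lemma sshom_id_local (X : superspace) (p : X) :
  local_morph (stalk_map (f := smap_id (ss_sheaf X)) (p := p)).
Proof.
move=> I J mI mJ _ [a Ia <-]; have [K [_ uK]] := ss_local p.
rewrite stalk_map_id.
by rewrite -(uK _ mJ) (uK _ mI).
Qed.

Definition sshom_id (X : superspace) : sshom X X := SSHom (@sshom_id_local X).

Lemma sshom_comp_local (X Y Z : superspace) (g : sshom Y Z) (f : sshom X Y) (p : X) :
  local_morph (stalk_map (f := smap_comp g f) (p := p)).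
Proof.
move=> I J mI mJ _ [a Ia <-]; have [K [mK _]] := ss_local (f p).
rewrite stalk_map_comp.
apply: (ss_map_local mK mJ); eexists; last by [].
by apply: (ss_map_local mI mK); exists a.
Qed.

Definition sshom_comp (X Y Z : superspace) (g : sshom Y Z) (f : sshom X Y) :
  sshom X Z := SSHom (@sshom_comp_local _ _ _ g f).

Section OpenSub.
Variables (X : superspace) (U : opens X).
Let OX := ss_sheaf X.

Definition sub_top : topologicalType := set_type (U : set X).

Lemma sub_img_open (V : opens sub_top) : open (set_val @` (V : set sub_top)).
Proof.
case: V => V [/= W oW eV] /=.
have -> : set_val @` V = W `&` U; last exact: openI oW (oset_open U).
apply/seteqP; split=> [_ [x Vx <-]|x [Wx Ux]].
  by split; [rewrite -eV in Vx | exact: set_valP].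
by exists (SigSub (mem_set Ux)) => //; rewrite -eV.
Qed.

Definition sub_img (V : opens sub_top) : opens X := Opens (sub_img_open V).

Lemma sub_imgS (V W : opens sub_top) : W `<=` V -> sub_img W `<=` sub_img V.
Proof. by move=> h _ [x Wx <-]; exists x => //; exact: h. Qed.

Definition sub_presheaf : spresheaf sub_top :=
  @SPresheaf sub_top (fun V => OX (sub_img V)) (fun V W h => res OX (sub_imgS h))
    (fun V W h => res_morph _ (sub_imgS h))
    (fun V h => res_id (sub_imgS h))
    (fun V W T h k l => res_comp (sub_imgS h) (sub_imgS k) (sub_imgS l)).

Lemma sub_val_open (V : set X) : open V -> open ((set_val : sub_top -> X) @^-1` V).
Proof. by move=> oV; exists V. Qed.

Lemma sub_img_preim (V : opens X) : sub_img (preim sub_val_open V) `<=` V.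
Proof. by move=> _ [x Vx <-]. Qed.

Lemma sub_smap_res (V W : opens X) (h : W `<=` V)
  (k : preim sub_val_open W `<=` preim sub_val_open V) (s : OX V) :
  res OX (@sub_img_preim W) (res OX h s) =
  res OX (sub_imgS k) (res OX (@sub_img_preim V) s).
Proof. by rewrite !(res_comp _ _ (subset_trans (@sub_img_preim W) h)). Qed.

Definition sub_smap : smap sub_presheaf OX :=
  @SMap sub_top X sub_presheaf OX set_val sub_val_open
    (fun V => res OX (@sub_img_preim V))
    (fun V => res_morph _ (@sub_img_preim V)) sub_smap_res.

Lemma sub_sheafP : is_ssheaf sub_presheaf.
Proof.
move=> I V W h cov s comp; apply: (@ss_sheafP X I (sub_img V)
  (fun i => sub_img (W i)) (fun i => sub_imgS (h i)) _ s).
  by move=> _ [x /cov [i _ Wx] <-]; exists i => //; exists x.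
move=> i j.
have k : opensI (sub_img (W i)) (sub_img (W j)) `<=` sub_img (opensI (W i) (W j)).
  by move=> _ [[x Wx <-] [y Wy /val_inj e]]; exists x => //; split=> //; rewrite -e.
have := congr1 (res OX k) (comp i j).
by rewrite (res_comp _ k (@opensIl _ _ _)) (res_comp _ k (@opensIr _ _ _)).
Qed.

Lemma sub_stalk_inj (p : sub_top) : injective (stalk_map (f := sub_smap) (p := p)).
Proof.
move=> a b; have [V [Vp [s [t [-> ->]]]]] := germP2 a b.
rewrite !stalk_mapE => /germ_eq [W [h [k [Wp /= e]]]].
have Wp' : oset (sub_img W) (set_val p) by exists p.
have l : sub_img W `<=` V by move=> _ [x Wx <-]; exact (h _ Wx).
apply/germ_eq; exists (sub_img W), l, l; split=> //=.
by move: e; rewrite !(res_comp _ _ l).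
Qed.

Lemma sub_stalk_surj (p : sub_top) (b : stalk_sr sub_presheaf p) :
  exists a, stalk_map (f := sub_smap) (p := p) a = b.
Proof.
have [V [Vp [s ->]]] := germP b.
have Vp' : oset (sub_img V) (set_val p) by exists p.
exists (germ Vp' s); rewrite stalk_mapE; apply/germ_eq.
have h : V `<=` preim sub_val_open (sub_img V) by move=> x Vx; exists x.
exists V, h, (@subset_refl _ _); split=> //=.
by rewrite (res_comp _ _ (@subset_refl _ _)); congr (res OX _ s);
  apply: Prop_irrelevance.
Qed.

Lemma open_sub_local (p : sub_top) : is_local (stalk_sr sub_presheaf p).
Proof.
apply: (local_iso (stalk_map_morph sub_smap p) (@sub_stalk_inj p) (@sub_stalk_surj p)).
exact: ss_local.
Qed.

Definition open_sub : superspace := Superspace sub_sheafP open_sub_local.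

Lemma open_incl_local (p : open_sub) : local_morph (stalk_map (f := sub_smap) (p := p)).
Proof.
apply: (local_morph_iso (stalk_map_morph sub_smap p) (@sub_stalk_inj p)
  (@sub_stalk_surj p)).
exact: ss_local.
Qed.

Definition open_incl : sshom open_sub X := @SSHom open_sub X sub_smap open_incl_local.

End OpenSub.

Record category := Category {
  ob :> Type;
  hom : ob -> ob -> Type;
  idm : forall X, hom X X;
  comp : forall X Y Z, hom Y Z -> hom X Y -> hom X Z;
  compA : forall W X Y Z (h : hom Y Z) (g : hom X Y) (f : hom W X),
    comp h (comp g f) = comp (comp h g) f;
  comp1m : forall X Y (f : hom X Y), comp (idm Y) f = f;
  compm1 : forall X Y (f : hom X Y), comp f (idm X) = f
}.
Arguments hom {c} _ _.
Arguments idm {c} _.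
Arguments comp {c X Y Z} _ _.

Declare Scope cat_scope.
Delimit Scope cat_scope with cat.
Notation "g ∘ f" := (comp g f) (at level 40, left associativity) : cat_scope.
Local Open Scope cat_scope.

Definition is_iso (C : category) (X Y : C) (f : hom X Y) : Prop :=
  exists g : hom Y X, g ∘ f = idm X /\ f ∘ g = idm Y.

Definition is_pullback (C : category) (A B X P : C) (f : hom A X) (g : hom B X)
  (p1 : hom P A) (p2 : hom P B) : Prop :=
  f ∘ p1 = g ∘ p2 /\
  forall (Q : C) (q1 : hom Q A) (q2 : hom Q B), f ∘ q1 = g ∘ q2 ->
    exists! u : hom Q P, p1 ∘ u = q1 /\ p2 ∘ u = q2.

Record topology (C : category) := Topology {
  Cov : forall (X : C) (I : Type) (U : I -> C), (forall i, hom (U i) X) -> Prop;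
  Cov_iso : forall (X V : C) (f : hom V X), is_iso f ->
    Cov (I := unit) (U := fun _ => V) (fun _ => f);
  Cov_pullback_ex : forall (X V : C) (g : hom V X) (I : Type) (U : I -> C)
    (f : forall i, hom (U i) X), Cov f ->
    forall i, exists (P : C) (p1 : hom P (U i)) (p2 : hom P V),
      is_pullback (f i) g p1 p2;
  Cov_pullback : forall (X V : C) (g : hom V X) (I : Type) (U : I -> C)
    (f : forall i, hom (U i) X), Cov f ->
    forall (P : I -> C) (p1 : forall i, hom (P i) (U i)) (p2 : forall i, hom (P i) V),
      (forall i, is_pullback (f i) g (p1 i) (p2 i)) -> Cov p2;
  Cov_comp : forall (X : C) (I : Type) (U : I -> C) (f : forall i, hom (U i) X)
    (J : I -> Type) (V : forall i, J i -> C) (g : forall i j, hom (V i j) (U i)),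
    Cov f -> (forall i, Cov (g i)) ->
    Cov (I := {i : I & J i}) (U := fun ij => V (projT1 ij) (projT2 ij))
        (fun ij => f (projT1 ij) ∘ g (projT1 ij) (projT2 ij))
}.
Arguments Cov {C} _ {X I U} _.

Record presheaf (C : category) := Presheaf {
  psh_ob :> C -> Type;
  psh_map : forall X Y (f : hom X Y), psh_ob Y -> psh_ob X;
  psh_id : forall X (x : psh_ob X), psh_map (idm X) x = x;
  psh_comp : forall X Y Z (g : hom Y Z) (f : hom X Y) x,
    psh_map (g ∘ f) x = psh_map f (psh_map g x)
}.
Arguments psh_map {C} _ {X Y} _ _.

Definition is_sheaf (C : category) (T : topology C) (F : presheaf C) : Prop :=
  forall (X : C) (I : Type) (U : I -> C) (f : forall i, hom (U i) X), Cov T f ->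
    injective (fun (x : F X) i => psh_map F (f i) x) /\
    forall xi : forall i, F (U i),
      (exists x : F X, (fun i => psh_map F (f i) x) = xi) <->
      (forall i j (P : C) (p1 : hom P (U i)) (p2 : hom P (U j)),
         is_pullback (f i) (f j) p1 p2 ->
         psh_map F p1 (xi i) = psh_map F p2 (xi j)).

Record nat_trans (C : category) (F G : presheaf C) := NatTrans {
  nt_map :> forall X, F X -> G X;
  nt_nat : forall X Y (f : hom X Y) (x : F Y),
    nt_map (psh_map F f x) = psh_map G f (nt_map x)
}.

Lemma nat_trans_eq (C : category) (F G : presheaf C) (a b : nat_trans F G) :
  (forall X (x : F X), a X x = b X x) -> a = b.
Proof.
case: a b => a na [b nb] /= e.
have eab : a = b by apply: functional_extensionality_dep => X; apply/funext.
by subst b; congr NatTrans; apply: Prop_irrelevance.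
Qed.

Section Presheaves.
Variable C : category.

Definition nt_id (F : presheaf C) : nat_trans F F :=
  @NatTrans C F F (fun _ x => x) (fun _ _ _ _ => erefl).

Lemma nt_comp_nat (F G H : presheaf C) (b : nat_trans G H) (a : nat_trans F G)
  (X Y : C) (f : hom X Y) (x : F Y) :
  b X (a X (psh_map F f x)) = psh_map H f (b Y (a Y x)).
Proof. by rewrite !nt_nat. Qed.

Definition nt_comp (F G H : presheaf C) (b : nat_trans G H) (a : nat_trans F G) :
  nat_trans F H := NatTrans (nt_comp_nat b a).

Definition nt_iso (F G : presheaf C) (a : nat_trans F G) : Prop :=
  exists b : nat_trans G F, nt_comp b a = nt_id F /\ nt_comp a b = nt_id G.

Definition yoneda (X : C) : presheaf C :=
  @Presheaf C (fun T => hom T X) (fun S T phi f => f ∘ phi)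
    (fun T f => compm1 f) (fun R S T g f x => compA x g f).

Definition yon_arrow (Z X : C) (a : nat_trans (yoneda Z) (yoneda X)) : hom Z X :=
  a Z (idm Z).

Definition representable (F : presheaf C) : Prop :=
  exists (X : C) (a : nat_trans (yoneda X) F), nt_iso a.

Section FiberProduct.
Variables (F G H : presheaf C) (f : nat_trans F H) (g : nat_trans G H).

Definition fp_ob (X : C) : Type := {x : F X * G X | f X x.1 = g X x.2}.

Lemma fp_map_subproof (X Y : C) (u : hom X Y) (x : fp_ob Y) :
  f X (psh_map F u (sval x).1) = g X (psh_map G u (sval x).2).
Proof. by rewrite !nt_nat (svalP x). Qed.

Definition fp_map (X Y : C) (u : hom X Y) (x : fp_ob Y) : fp_ob X :=
  exist _ (psh_map F u (sval x).1, psh_map G u (sval x).2) (fp_map_subproof u x).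

Lemma fp_eq (X : C) (x y : fp_ob X) : sval x = sval y -> x = y.
Proof. by case: x y => x hx [y hy] /= e; exact: eq_exist. Qed.

Lemma fp_id (X : C) (x : fp_ob X) : fp_map (idm X) x = x.
Proof. by apply: fp_eq; rewrite /= !psh_id; case: (sval x). Qed.

Lemma fp_comp (X Y Z : C) (v : hom Y Z) (u : hom X Y) (x : fp_ob Z) :
  fp_map (v ∘ u) x = fp_map u (fp_map v x).
Proof. by apply: fp_eq; rewrite /= !psh_comp. Qed.

Definition fib_prod : presheaf C := Presheaf fp_id fp_comp.

Definition fp_pr2 : nat_trans fib_prod G :=
  @NatTrans C fib_prod G (fun _ x => (sval x).2) (fun _ _ _ _ => erefl).

End FiberProduct.

Definition representable_nt (F G : presheaf C) (f : nat_trans F G) : Prop :=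
  forall (X : C) (g : nat_trans (yoneda X) G), representable (fib_prod f g).

Definition is_mono (F G : presheaf C) (f : nat_trans F G) : Prop :=
  forall (H : presheaf C) (a b : nat_trans H F), nt_comp f a = nt_comp f b -> a = b.

End Presheaves.

Lemma sshom_compA (W X Y Z : superspace) (h : sshom Y Z) (g : sshom X Y)
  (f : sshom W X) : sshom_comp h (sshom_comp g f) = sshom_comp (sshom_comp h g) f.
Proof. by apply: sshom_eq; exact: smap_eq. Qed.

Lemma sshom_comp1m (X Y : superspace) (f : sshom X Y) :
  sshom_comp (sshom_id Y) f = f.
Proof. by apply: sshom_eq; case: f => -[b bo c m r] l /=; exact: smap_eq. Qed.

Lemma sshom_compm1 (X Y : superspace) (f : sshom X Y) :
  sshom_comp f (sshom_id X) = f.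
Proof. by apply: sshom_eq; case: f => -[b bo c m r] l /=; exact: smap_eq. Qed.

Definition SSpaces : category := Category sshom_compA sshom_comp1m sshom_compm1.

Definition full (C : category) (P : C -> Prop) : category :=
  @Category {X : C | P X} (fun X Y => hom (sval X) (sval Y)) (fun X => idm (sval X))
    (fun X Y Z g f => g ∘ f) (fun W X Y Z h g f => compA h g f)
    (fun X Y f => comp1m f) (fun X Y f => compm1 f).

Definition open_embedding (Y X : SSpaces) (f : hom Y X) : Prop :=
  exists (U : opens X) (phi : hom Y (open_sub U : SSpaces)),
    is_iso phi /\ f = (open_incl U : hom (open_sub U : SSpaces) X) ∘ phi.

(* [glue_map i j] is phi_ji : U_ij -> U_ji.  In the cocycle condition,
   [a], [b] and [c] are the (unique) factorizations of the displayed maps through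
   open subsuperspaces; the existence of [c] says that phi_kj o phi_ji
   is defined on the intersection of U_ij and U_ik. *)
Record gluing_datum := GluingDatum {
  glue_ix : Type;
  glue_ob : glue_ix -> SSpaces;
  glue_open : forall i, glue_ix -> opens (glue_ob i);
  glue_refl : forall i x, oset (glue_open i i) x;
  glue_sub : glue_ix -> glue_ix -> SSpaces := fun i j => open_sub (glue_open i j);
  glue_incl : forall i j, hom (glue_sub i j) (glue_ob i) :=
    fun i j => open_incl (glue_open i j);
  glue_map : forall i j, hom (glue_sub i j) (glue_sub j i);
  glue_iso : forall i j, is_iso (glue_map i j);
  glue_cocycle : forall i j k,
    let W := opensI (glue_open i j) (glue_open i k) in
    exists (a : hom (open_sub W : SSpaces) (glue_sub i j))
           (b : hom (open_sub W : SSpaces) (glue_sub i k))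
           (c : hom (open_sub W : SSpaces) (glue_sub j k)),
      [/\ glue_incl i j ∘ a = open_incl W,
          glue_incl i k ∘ b = open_incl W,
          glue_incl j k ∘ c = glue_incl j i ∘ (glue_map i j ∘ a) &
          glue_incl k i ∘ (glue_map i k ∘ b) = glue_incl k j ∘ (glue_map j k ∘ c)]
}.

Record is_gluing (D : gluing_datum) (X : SSpaces)
  (phi : forall i, hom (glue_ob (g := D) i) X) : Prop := IsGluing {
  gluing_emb : forall i, open_embedding (phi i);
  gluing_cover : forall x : X, exists i (y : glue_ob (g := D) i), phi i y = x;
  gluing_compat : forall i j,
    phi i ∘ glue_incl i j = phi j ∘ (glue_incl j i ∘ glue_map i j);
  gluing_meet : forall i j,
    phi i @` glue_open i j = phi j @` glue_open j i /\
    phi j @` glue_open j i = range (phi i) `&` range (phi j)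
}.

(* The converse [site_cov_all] is imposed as well, so that the coverings are all
   the jointly surjective families of open embeddings; in particular the maps
   U_i -> X attached to a gluing datum cover X.  With [site_cov_emb] and
   [site_cov_surj] alone, a sheaf with an open covering by representable functors
   need not be representable.  For instance, in all superspaces, let the coverings
   be the families of open embeddings having a jointly surjective finite
   subfamily, let k be a one-point superspace, and let F(X) be the set of
   morphisms from X to the sum of countably many copies of k that take finitely
   many values: F is a sheaf with an open covering by copies of k, and it is not
   representable. *)
Record superspace_site (P : SSpaces -> Prop) (T : topology (full P)) : Prop :=
  SuperspaceSite {
  site_cov_emb : forall (X : full P) (I : Type) (U : I -> full P)
    (f : forall i, hom (U i) X), Cov T f ->
    forall i, open_embedding (Y := sval (U i)) (X := sval X) (f i);
  site_cov_surj : forall (X : full P) (I : Type) (U : I -> full P)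
    (f : forall i, hom (U i) X), Cov T f ->
    \bigcup_i range (base (f i : sshom (sval (U i)) (sval X))) = setT;
  site_cov_all : forall (X : full P) (I : Type) (U : I -> full P)
    (f : forall i, hom (U i) X),
    (forall i, open_embedding (Y := sval (U i)) (X := sval X) (f i)) ->
    \bigcup_i range (base (f i : sshom (sval (U i)) (sval X))) = setT ->
    Cov T f;
  site_open : forall X : SSpaces, P X -> forall U : opens X, P (open_sub U);
  (* The glued superspace is unique up to isomorphism only, and P need not be
     closed under isomorphisms. *)
  site_glue : forall D : gluing_datum, (forall i, P (glue_ob (g := D) i)) ->
    exists (X : SSpaces) (phi : forall i, hom (glue_ob (g := D) i) X),
      is_gluing phi /\ P X
}.

Section OpenCoverings.
Variables (P : SSpaces -> Prop) (T : topology (full P)).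

Definition open_subfunctor (U G : presheaf (full P)) (f : nat_trans U G) : Prop :=
  [/\ is_mono f, representable_nt f &
      forall (X : full P) (g : nat_trans (yoneda X) G) (Z : full P)
        (a : nat_trans (yoneda Z) (fib_prod f g)), nt_iso a ->
      open_embedding (Y := sval Z) (X := sval X)
        (yon_arrow (nt_comp (fp_pr2 f g) a))].

Definition open_covering (F : presheaf (full P)) (I : Type)
  (U : I -> presheaf (full P)) (f : forall i, nat_trans (U i) F) : Prop :=
  (forall i, open_subfunctor (f i)) /\
  forall (X : full P) (g : nat_trans (yoneda X) F) (Z : I -> full P)
    (a : forall i, nat_trans (yoneda (Z i)) (fib_prod (f i) g)),
    (forall i, nt_iso (a i)) ->
    Cov T (fun i => yon_arrow (nt_comp (fp_pr2 (f i) g) (a i))).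

Definition has_open_covering_by_representables (F : presheaf (full P)) : Prop :=
  exists (I : Type) (U : I -> presheaf (full P)) (f : forall i, nat_trans (U i) F),
    open_covering f /\ forall i, representable (U i).

End OpenCoverings.

(* Main.v *)
From HB Require Import structures.
From mathcomp Require Import all_boot all_algebra.
From mathcomp Require Import boolp classical_sets functions.
From mathcomp Require Import topology_structure initial_topology subtype_topology.
Require Import Defs.

Set Implicit Arguments.
Unset Strict Implicit.
Unset Printing Implicit Defensive.

Import GRing.Theory.
Local Open Scope classical_set_scope.
Local Open Scope ring_scope.
Local Open Scope cat_scope.

(* The covering of F by representables amounts to objects X_i with elements u_i of
   F(X_i) such that each s |-> F(s)(u_i) is injective and, for every y in F(Y), the
   maps to Y along which y becomes a pullback of u_i are those landing in a fixed
   open set W_i of Y, the W_i covering Y.  Applied to the u_j themselves this gives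
   opens U_ij in X_i and transition maps, whose cocycle condition follows from
   injectivity.  Let X be the glued superspace.  As the X_i cover X and F is a sheaf,
   the u_i glue to some x in F(X), and t |-> F(t)(x) is a bijection from Hom(S, X) to
   F(S): injective because morphisms to X can be compared locally, where they factor
   through charts, and surjective because Hom(-, X) is a sheaf, i.e. morphisms of
   superspaces glue.  The latter fact also gives the converse. *)

(** * Local comparison of morphisms and of sections *)

Section Restriction.
Variables (X : topologicalType) (O : spresheaf X).
Variables (U0 U1 U2 U3 : opens X).
Variables (h1 : U1 `<=` U0) (h2 : U2 `<=` U1) (h3 : U3 `<=` U2).

Lemma res_comp3 (l : U3 `<=` U0) s : res O h3 (res O h2 (res O h1 s)) = res O l s.
Proof. by rewrite (res_comp _ _ (subset_trans h3 h2)); exact: res_comp. Qed.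

Lemma res_comp4 (U4 : opens X) (h4 : U4 `<=` U3) (l : U4 `<=` U0) s :
  res O h4 (res O h3 (res O h2 (res O h1 s))) = res O l s.
Proof. by rewrite (res_comp3 (subset_trans (subset_trans h3 h2) h1)); exact: res_comp. Qed.

End Restriction.

(** The sections [comap f s] and [comap g s] live over preimages under two different base maps, so
    they are compared after restriction to any [W] inside both; no transport along an equality of
    base maps is then needed. *)
Lemma smap_ext (X Y : topologicalType) (OX : spresheaf X) (OY : spresheaf Y)
  (f g : smap OX OY) : (forall p, f p = g p) ->
  (forall (V : opens Y) (W : opens X) (h : W `<=` spreim f V)
    (k : W `<=` spreim g V) (s : OY V),
    res OX h (comap f s) = res OX k (comap g s)) -> f = g.
Proof.
case: f g => [b bo c m r] [b' bo' c' m' r'] /= /funext eb; subst b'.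
have ebo := Prop_irrelevance bo bo'; subst bo' => ec.
suff e : c = c' by subst c'; exact: smap_eq.
apply: functional_extensionality_dep => V; apply/funext => s.
have := ec V (preim bo V) (@subset_refl _ _) (@subset_refl _ _) s.
by rewrite /= !res_id.
Qed.

Lemma comap_congr (X Y : topologicalType) (OX : spresheaf X) (OY : spresheaf Y)
  (f g : smap OX OY) : f = g ->
  forall (V : opens Y) (W : opens X) (h : W `<=` spreim f V)
    (k : W `<=` spreim g V) (s : OY V),
    res OX h (comap f s) = res OX k (comap g s).
Proof. by move=> -> V W h k s; exact: smap_id_res. Qed.

Lemma section_separated (X : superspace) (I : Type) (U : opens X)
  (V : I -> opens X) (h : forall i, V i `<=` U) : U `<=` \bigcup_i V i ->
  forall s t : ss_sheaf X U,
  (forall i, res (ss_sheaf X) (h i) s = res (ss_sheaf X) (h i) t) -> s = t.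
Proof.
move=> cov s t e; set O := ss_sheaf X in s t e *.
have compat i j : res O (@opensIl _ (V i) (V j)) (res O (h i) t) =
    res O (@opensIr _ (V i) (V j)) (res O (h j) t).
  by rewrite !(res_comp _ _ (subset_trans (@opensIl _ (V i) (V j)) (h i))).
have [r [_ ru]] := @ss_sheafP X I U V h cov _ compat.
by rewrite -(ru s) // (ru t).
Qed.

(** The component of the wrong parity restricts on each [V i] to a difference of two elements of
    parity [b]. It has both parities there, hence vanishes locally and so globally. *)
Lemma section_homog (X : superspace) (I : Type) (U : opens X)
  (V : I -> opens X) (h : forall i, V i `<=` U) : U `<=` \bigcup_i V i ->
  forall b (s : ss_sheaf X U),
  (forall i, homog b (res (ss_sheaf X) (h i) s)) -> homog b s.
Proof.
move=> cov b s hs; have [s0 [s1 [h0 h1 es]]] := homog_sum s.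
have r0 i := srmH (res_morph (ss_sheaf X) (h i)) h0.
have r1 i := srmH (res_morph (ss_sheaf X) (h i)) h1.
case: b hs => hs.
- suff e0 : s0 = 0 by rewrite es e0 add0r.
  apply: (section_separated (h := h) cov) => i; rewrite (srm0 (res_morph _ (h i))).
  apply: homog_direct => //.
  by have := homogB (hs i) (r1 i); rewrite es res_add addrK.
- suff e1 : s1 = 0 by rewrite es e1 addr0.
  apply: (section_separated (h := h) cov) => i; rewrite (srm0 (res_morph _ (h i))).
  apply: homog_direct => //.
  by have := homogB (hs i) (r0 i); rewrite es res_add addrC addKr.
Qed.

(** * Factorization of morphisms through open subsuperspaces *)

Section Factor.
Variables (T X : superspace) (U : opens X) (f : sshom T X).
Hypothesis fU : forall p, oset U (f p).

Definition corestr_base (p : T) : sub_top U := SigSub (mem_set (fU p)).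

Lemma corestr_base_open (V : set (sub_top U)) : open V -> open (corestr_base @^-1` V).
Proof. by case=> W oW <-; exact: (base_open f oW). Qed.

Lemma corestr_sub (V : opens (sub_top U)) :
  preim corestr_base_open V `<=` spreim f (sub_img V).
Proof. by move=> x Vx; exists (corestr_base x). Qed.

Lemma corestr_res (V W : opens (sub_top U)) (h : W `<=` V)
  (k : preim corestr_base_open W `<=` preim corestr_base_open V)
  (s : sub_presheaf U V) :
  res (ss_sheaf T) (@corestr_sub W) (comap f (res (sub_presheaf U) h s)) =
  res (ss_sheaf T) k (res (ss_sheaf T) (@corestr_sub V) (comap f s)).
Proof.
rewrite /= (comap_res _ (spreimS (f := f) (sub_imgS h))).
by rewrite !(res_comp _ _ (subset_trans k (@corestr_sub V))).
Qed.

Lemma corestr_morph (V : opens (sub_top U)) : srmorph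
  (fun s : sub_presheaf U V => res (ss_sheaf T) (@corestr_sub V) (comap f s)).
Proof. exact (srmorph_comp (comap_morph f _) (res_morph _ _)). Qed.

Definition corestr_smap : smap (ss_sheaf T) (sub_presheaf U) :=
  SMap corestr_morph corestr_res.

Lemma corestr_smapE : smap_comp (sub_smap U) corestr_smap = f :> smap _ _.
Proof.
apply: smap_ext => // V W h k s /=.
have l : sub_img (preim (@sub_val_open _ U) V) `<=` V by exact: sub_img_preim.
rewrite (comap_res _ (spreimS (f := f) l)).
have m : preim corestr_base_open (preim (@sub_val_open _ U) V) `<=` spreim f V by [].
rewrite (res_comp _ (@corestr_sub _) m).
exact: res_comp.
Qed.

(* The stalk maps of the inclusion of U are isomorphisms, so locality of the
   corestriction follows from that of f; similarly for [glue_local]. *)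
Lemma corestr_local (p : T) : local_morph (stalk_map (f := corestr_smap) (p := p)).
Proof.
move=> I J mI mJ _ [a Ia <-].
have lf : local_morph (stalk_map (f := smap_comp (sub_smap U) corestr_smap) (p := p)).
  by rewrite corestr_smapE; exact: ss_map_local.
have inj := @sub_stalk_inj X U (corestr_smap p).
have sur := @sub_stalk_surj X U (corestr_smap p).
have [b eb] := sur a.
have mI' := maximal_preim (stalk_map_morph (sub_smap U) (corestr_smap p)) inj sur mI.
have := lf _ J mI' mJ; apply; exists b; first by rewrite /preimage /= eb.
by rewrite stalk_map_comp eb.
Qed.

Definition corestr : sshom T (open_sub U) := @SSHom T (open_sub U) corestr_smap corestr_local.

Lemma corestrE : sshom_comp (open_incl U) corestr = f.
Proof. by apply: sshom_eq; exact: corestr_smapE. Qed.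

End Factor.

Lemma open_incl_mono (T X : superspace) (U : opens X) (f g : sshom T (open_sub U)) :
  sshom_comp (open_incl U) f = sshom_comp (open_incl U) g -> f = g.
Proof.
move=> e; apply: sshom_eq; apply: smap_ext => [p|V W h k s].
  by apply: val_inj; exact: (congr1 (fun u : sshom T X => u p) e).
have VP : V `<=` preim (@sub_val_open _ U) (sub_img V) by move=> x Vx; exists x.
(* A section over [V] is by definition a section of [X] over the image of [V], so [s] is the
   pullback of itself along the inclusion. The comaps of [f] and [g] are thus determined by the
   composites with the inclusion. *)
have -> : s = res (sub_presheaf U) VP (comap (sub_smap U) s).
  by rewrite /= (res_comp _ _ (@subset_refl _ _)) res_id.
rewrite (comap_res _ (spreimS (f := f) VP)) (comap_res _ (spreimS (f := g) VP)).
rewrite (res_comp _ _ (subset_trans h (spreimS VP))).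
rewrite (res_comp _ _ (subset_trans k (spreimS VP))).
exact (comap_congr (congr1 (@ss_map T X) e) (V := sub_img V) (W := W)
  (subset_trans h (spreimS (f := f) VP)) (subset_trans k (spreimS (f := g) VP)) s).
Qed.

Definition sub_pt (X : superspace) (U : opens X) (p : X) (Up : oset U p) : open_sub U :=
  SigSub (mem_set Up).

(** * Gluing of morphisms of superspaces along an open cover *)

Section GlueHom.
Variables (X Y : superspace) (I : Type) (W : I -> opens X).
Variable g : forall i, sshom (open_sub (W i)) Y.
Hypothesis cov : forall p, exists i, oset (W i) p.
Arguments cov : clear implicits.
Hypothesis compat : forall i j
  (a : sshom (open_sub (opensI (W i) (W j))) (open_sub (W i)))
  (b : sshom (open_sub (opensI (W i) (W j))) (open_sub (W j))),
  sshom_comp (open_incl (W i)) a = open_incl _ ->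
  sshom_comp (open_incl (W j)) b = open_incl _ ->
  sshom_comp (g i) a = sshom_comp (g j) b.
Let OX := ss_sheaf X.
Let OY := ss_sheaf Y.

Let left_incl i j : sshom (open_sub (opensI (W i) (W j))) (open_sub (W i)) :=
  corestr (f := open_incl (opensI (W i) (W j)))
    (fun p => @opensIl _ _ _ _ (set_valP p)).
Let right_incl i j : sshom (open_sub (opensI (W i) (W j))) (open_sub (W j)) :=
  corestr (f := open_incl (opensI (W i) (W j)))
    (fun p => @opensIr _ _ _ _ (set_valP p)).

Let overlap i j :
  sshom_comp (g i) (left_incl i j) = sshom_comp (g j) (right_incl i j).
Proof. by apply: compat; exact: corestrE. Qed.

Definition glue_base (p : X) : Y :=
  g _ (sub_pt (U := W (projT1 (cid (cov p)))) (projT2 (cid (cov p)))).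

(** The index used by [glue_base] at a point is chosen arbitrarily; evaluating [overlap] at that
    point shows that the value does not depend on it. *)
Lemma glue_baseE i (q : sub_top (W i)) : glue_base (set_val q) = g i q.
Proof.
rewrite /glue_base; move: (projT1 _) (projT2 _) => /= j h.
have hij : oset (opensI (W j) (W i)) (set_val q) by split=> //; exact: set_valP.
have := congr1 (fun u : sshom _ Y => u (sub_pt hij)) (overlap j i).
move=> /= e; transitivity (g j (left_incl j i (sub_pt hij))).
  by congr (base (g _) _); apply: val_inj.
by rewrite [LHS]e; congr (base (g _) _); apply: val_inj.
Qed.

(** The open set of [X] over which [comap (g i)] of a section over [V] lives. As [i] varies, these
    sets cover the preimage of [V], and the glued section is assembled from them. *)
Definition glue_piece (V : opens Y) i : opens X := sub_img (spreim (g i) V).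

Lemma glue_preimE (V : set Y) (oV : open V) :
  glue_base @^-1` V = \bigcup_i glue_piece (Opens oV) i.
Proof.
apply/seteqP; split=> [p Vp|_ [i _ [q Vq <-]]]; last by rewrite /preimage /= glue_baseE.
have [i Wp] := cov p; exists i => //.
by exists (sub_pt Wp) => //=; move: Vp; rewrite /preimage /= -glue_baseE.
Qed.

Lemma glue_base_open (V : set Y) : open V -> open (glue_base @^-1` V).
Proof. by move=> oV; rewrite glue_preimE; apply: bigcup_open => i _; exact: oset_open. Qed.

Lemma glue_pieceS (V : opens Y) i : glue_piece V i `<=` preim glue_base_open V.
Proof. by move=> _ [q Vq <-] /=; rewrite /preimage /= glue_baseE. Qed.

Lemma glue_piece_cover (V : opens Y) :
  preim glue_base_open V `<=` \bigcup_i glue_piece V i.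
Proof. by case: V => V oV /=; rewrite glue_preimE. Qed.

Lemma glue_piece_meet (V : opens Y) i j (N : opens X)
  (h : N `<=` glue_piece V i) (k : N `<=` glue_piece V j) (s : OY V) :
  res OX h (comap (g i) s) = res OX k (comap (g j) s).
Proof.
set M := spreim (sshom_comp (g i) (left_incl i j)) V.
have M' : M `<=` spreim (sshom_comp (g j) (right_incl i j)) V by rewrite -overlap.
have NM : N `<=` sub_img M.
  move=> p Np; have [q Vq eq] := h p Np; have [r _ er] := k p Np.
  have hij : oset (opensI (W i) (W j)) p.
    by split; [rewrite -eq | rewrite -er]; exact: set_valP.
  exists (sub_pt hij) => //.
  by rewrite /M /spreim /preim /preimage /=; congr (oset V (base (g _) _)): Vq; apply: val_inj.
have := comap_congr (congr1 (@ss_map _ _) (overlap i j)) (@subset_refl _ M) M' s.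
move/(congr1 (res OX NM)) => e.
(* The sheaf of an open subsuperspace is that of [X] on images, so each side of [e] unfolds to four
   successive restrictions in [OX]. *)
exact (etrans (esym (res_comp4 _ _ _ NM h _)) (etrans e (res_comp4 _ _ _ NM k _))).
Qed.

Lemma glue_comap_ex (V : opens Y) (s : OY V) :
  exists t : OX (preim glue_base_open V),
    forall i, res OX (@glue_pieceS V i) t = comap (g i) s.
Proof.
have [|t [et _]] := @ss_sheafP X I (preim glue_base_open V) (glue_piece V)
  (@glue_pieceS V) (@glue_piece_cover V) (fun i => comap (g i) s).
  by move=> i j; exact: glue_piece_meet.
by exists t.
Qed.

Definition glue_comap (V : opens Y) (s : OY V) : OX (preim glue_base_open V) :=
  projT1 (cid (glue_comap_ex s)).

Lemma glue_comapE (V : opens Y) (s : OY V) i :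
  res OX (@glue_pieceS V i) (glue_comap s) = comap (g i) s.
Proof. exact: (projT2 (cid (glue_comap_ex s))). Qed.

(** The glued section is a choice, but it is determined by its restrictions to the pieces; all
    identities, and the parity, are checked there, where [glue_comap] becomes [comap (g i)]. *)
Lemma glue_comap_morph (V : opens Y) : srmorph (@glue_comap V).
Proof.
have sep := section_separated (h := @glue_pieceS V) (@glue_piece_cover V).
have mr i := res_morph OX (@glue_pieceS V i).
have mg i := comap_morph (g i) V.
split=> [s t||b s hs].
- by apply: sep => i; rewrite (srmB (mr i)) !glue_comapE; exact: (srmB (mg i)).
- split=> [|s t]; apply: sep => i.
    by rewrite (srm1 (mr i)) glue_comapE; exact: (srm1 (mg i)).
  by rewrite (srmM (mr i)) !glue_comapE; exact: (srmM (mg i)).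
- apply: (section_homog (h := @glue_pieceS V) (@glue_piece_cover V)) => i.
  by rewrite glue_comapE; exact: (srmH (mg i)).
Qed.

Lemma glue_comap_res (V V' : opens Y) (h : V' `<=` V)
  (k : preim glue_base_open V' `<=` preim glue_base_open V) (s : OY V) :
  glue_comap (res OY h s) = res OX k (glue_comap s).
Proof.
apply: (section_separated (h := @glue_pieceS V') (@glue_piece_cover V')) => i.
rewrite glue_comapE (@comap_res _ _ _ _ (g i) _ _ h (spreimS (f := g i) h)).
by rewrite -glue_comapE /= !(res_comp _ _ (subset_trans (@glue_pieceS V' i) k)).
Qed.

Definition glue_smap : smap OX OY := SMap glue_comap_morph glue_comap_res.

Lemma glue_smapE i : smap_comp glue_smap (sub_smap (W i)) = g i :> smap _ _.
Proof.
apply: smap_ext => [q|V N h k s]; first exact: glue_baseE.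
rewrite -glue_comapE /=.
have l : sub_img N `<=` preim glue_base_open V.
  by move=> _ [q Nq <-]; exact: h.
by rewrite !(res_comp _ _ l).
Qed.

Lemma glue_local (p : X) : local_morph (stalk_map (f := glue_smap) (p := p)).
Proof.
move=> J K mJ mK _ [a Ja <-]; have [i Wp] := cov p.
pose q : open_sub (W i) := sub_pt Wp.
have lg : local_morph (stalk_map (f := smap_comp glue_smap (sub_smap (W i))) (p := q)).
  by rewrite glue_smapE; exact: ss_map_local.
have inj := @sub_stalk_inj X (W i) q.
have sur := @sub_stalk_surj X (W i) q.
have mK' := maximal_im (stalk_map_morph (sub_smap (W i)) q) inj sur mK.
have [b Kb] := lg J _ mJ mK' _ (ex_intro2 _ _ a Ja erefl).
by rewrite stalk_map_comp => /inj <-.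
Qed.

Definition glue_hom : sshom X Y := SSHom glue_local.

Lemma glue_homE i : sshom_comp glue_hom (open_incl (W i)) = g i.
Proof. by apply: sshom_eq; exact: glue_smapE. Qed.

End GlueHom.

Lemma sshom_separated (X Y : superspace) (I : Type) (W : I -> opens X)
  (f g : sshom X Y) : (forall p, exists i, oset (W i) p) ->
  (forall i, sshom_comp f (open_incl (W i)) = sshom_comp g (open_incl (W i))) ->
  f = g.
Proof.
move=> cov e; apply: sshom_eq; apply: smap_ext => [p|V N h k s].
  have [i Wp] := cov p.
  exact: (congr1 (fun u : sshom _ Y => u (sub_pt Wp)) (e i)).
pose Ni i := opensI N (W i).
apply: (section_separated (V := Ni) (h := fun i => @opensIl _ N (W i))).
  by move=> p Np; have [i Wp] := cov p; exists i.
move=> i; have := comap_congr (congr1 (@ss_map _ _) (e i))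
  (W := preim (@sub_val_open X (W i)) N) (fun q Nq => h _ Nq) (fun q Nq => k _ Nq) s.
have NiS : Ni i `<=` sub_img (preim (@sub_val_open X (W i)) N).
  by move=> p [Np Wp]; exists (sub_pt Wp).
move/(congr1 (res (ss_sheaf X) NiS)) => /=.
rewrite !(res_comp _ _ (subset_trans (@opensIl _ N (W i)) h)).
rewrite !(res_comp _ _ (subset_trans (@opensIl _ N (W i)) k)).
have l := subset_trans NiS (@sub_img_preim X (W i) N).
move=> e1.
exact (etrans (esym (res_comp3 _ _ _ _ _)) (etrans e1 (res_comp3 _ _ _ _ _))).
Qed.

(** * Open embeddings *)

Local Notation oincl U := (open_incl U : @hom SSpaces (open_sub U) _).

(** The open set is the whole space. Its [open_sub] has a subset type as carrier and is only
    isomorphic to [X], so [f] is first corestricted; the inverse is checked after composition with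
    the monic inclusion. *)
Lemma iso_open_embedding (X Y : SSpaces) (f : hom Y X) : is_iso f -> open_embedding f.
Proof.
move=> [g [gf fg]]; pose U : opens X := Opens openT.
pose phi : hom Y (open_sub U : SSpaces) := corestr (U := U) (f := f) (fun=> I).
have phiE : oincl U ∘ phi = f by exact: corestrE.
exists U, phi; split=> //; exists (g ∘ oincl U); split.
  by rewrite -compA phiE.
apply: open_incl_mono; rewrite -[LHS]/(oincl U ∘ (phi ∘ (g ∘ oincl U))).
rewrite 2!compA phiE fg comp1m; exact: (esym (sshom_compm1 _)).
Qed.

Section OpenEmbedding.
Variables (X Y : SSpaces) (f : hom Y X).
Hypothesis fE : open_embedding f.

Lemma open_embedding_open : exists U : opens X, oset U = range (base (f : sshom Y X)).
Proof.
have [U [phi [[psi [_ phipsi]] ->]]] := fE.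
exists U; apply/seteqP; split=> [p Up|_ [q _ <-]]; last exact: set_valP.
exists (psi (sub_pt Up)) => //=.
by have /= -> := congr1 (fun u : sshom _ _ => u (sub_pt Up)) phipsi.
Qed.

Lemma open_embedding_inj : injective (base (f : sshom Y X)).
Proof.
have [U [phi [[psi [psiphi _]] ->]]] := fE.
move=> p q /= /val_inj e.
have E r : psi (phi r) = r by exact: (congr1 (fun u : sshom _ _ => u r) psiphi).
by rewrite -(E p) -(E q) e.
Qed.

Lemma open_embedding_mono (Z : SSpaces) (a b : hom Z Y) : f ∘ a = f ∘ b -> a = b.
Proof.
have [U [phi [[psi [psiphi _]] ->]]] := fE.
rewrite -!compA => /open_incl_mono e.
by rewrite -(comp1m a) -(comp1m b) -psiphi -!compA [phi ∘ a]e.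
Qed.

Lemma open_embedding_lift (Z : SSpaces) (t : hom Z X) :
  range (base (t : sshom Z X)) `<=` range (base (f : sshom Y X)) ->
  exists s : hom Z Y, f ∘ s = t.
Proof.
have [U [phi [[psi [_ phipsi]] ->]]] := fE.
move=> tf; have tU p : oset U (t p).
  by have [|q _ <-] := tf (t p); [exists p|exact: set_valP].
exists (psi ∘ corestr tU); rewrite -compA (compA phi) phipsi comp1m.
exact: corestrE.
Qed.

End OpenEmbedding.

Section OpenEmbeddingFamily.
Variables (X : SSpaces) (I : Type) (U : I -> SSpaces) (f : forall i, hom (U i) X).
Hypothesis fE : forall i, open_embedding (f i).
Hypothesis fcov : \bigcup_i range (base (f i : sshom (U i) X)) = setT.
Variable Y : SSpaces.

Lemma hom_separated (a b : hom X Y) : (forall i, a ∘ f i = b ∘ f i) -> a = b.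
Proof.
move=> e; have [W phiP] := choice fE.
apply: (@sshom_separated X Y I W).
  move=> p; have [i _ [q _ <-]] : (\bigcup_i range (base (f i : sshom (U i) X))) p.
    by rewrite fcov.
  exists i; have [phi [_ ->]] := phiP i; exact: set_valP.
move=> i; have [phi [[psi [_ phipsi]] fi]] := phiP i.
have ei : oincl (W i) = f i ∘ psi.
  by rewrite fi -compA phipsi compm1.
by rewrite -[LHS]/(a ∘ oincl (W i)) -[RHS]/(b ∘ oincl (W i)) ei !compA e.
Qed.

(* Agreement is tested on open subsuperspaces of X rather than on fibered products,
   since the former belong to the full subcategory of any superspace site. *)
Lemma hom_glue (xi : forall i, hom (U i) Y) :
  (forall i j (N : opens X) (p1 : hom (open_sub N : SSpaces) (U i))
    (p2 : hom (open_sub N : SSpaces) (U j)),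
    f i ∘ p1 = f j ∘ p2 -> xi i ∘ p1 = xi j ∘ p2) ->
  exists a : hom X Y, forall i, a ∘ f i = xi i.
Proof.
move=> compat; have [W WP] := choice fE.
pose phi i := projT1 (cid (WP i)).
have phiP i : is_iso (phi i) /\ f i = oincl (W i) ∘ phi i := projT2 (cid (WP i)).
pose psi i := projT1 (cid (phiP i).1).
have psiP i : psi i ∘ phi i = idm (U i) /\ phi i ∘ psi i = idm _ :=
  projT2 (cid (phiP i).1).
have fi i : f i = oincl (W i) ∘ phi i by have [] := phiP i.
have ei i : oincl (W i) = f i ∘ psi i.
  by rewrite fi -compA (psiP i).2 compm1.
have cov p : exists i, oset (W i) p.
  have [i _ [q _ <-]] : (\bigcup_i range (base (f i : sshom (U i) X))) p by rewrite fcov.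
  by exists i; rewrite fi; exact: set_valP.
pose g i : sshom (open_sub (W i)) Y := xi i ∘ psi i.
have gcompat i j (a : sshom (open_sub (opensI (W i) (W j))) (open_sub (W i)))
  (b : sshom (open_sub (opensI (W i) (W j))) (open_sub (W j))) :
  sshom_comp (open_incl (W i)) a = open_incl _ ->
  sshom_comp (open_incl (W j)) b = open_incl _ ->
  sshom_comp (g i) a = sshom_comp (g j) b.
  move=> ea eb; rewrite -[LHS]/(xi i ∘ psi i ∘ a) -[RHS]/(xi j ∘ psi j ∘ b) -!compA.
  apply: compat; rewrite 2!compA -!ei; exact: etrans ea (esym eb).
exists (glue_hom cov gcompat) => i.
rewrite fi compA -[X in X ∘ _]/(sshom_comp _ _) glue_homE.
by rewrite -[g i]/(xi i ∘ psi i) -compA (psiP i).1 compm1.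
Qed.

End OpenEmbeddingFamily.

(** * Natural isomorphisms and Yoneda's lemma *)

Section NatIso.
Variables (C : category) (F G : presheaf C) (a : nat_trans F G).

Lemma nt_isoP : nt_iso a ->
  exists b : nat_trans G F, (forall X, cancel (a X) (b X)) /\ (forall X, cancel (b X) (a X)).
Proof.
move=> [b [ba ab]]; exists b; split=> X x.
  exact: (congr1 (fun c : nat_trans F F => c X x) ba).
exact: (congr1 (fun c : nat_trans G G => c X x) ab).
Qed.

Lemma nt_iso_bij : (forall X, injective (a X)) ->
  (forall X y, exists x, a X x = y) -> nt_iso a.
Proof.
move=> inj surj; pose b X y := projT1 (cid (surj X y)).
have bK X y : a X (b X y) = y := projT2 (cid (surj X y)).
have bn X Y (f : hom X Y) y : b X (psh_map G f y) = psh_map F f (b Y y).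
  by apply: inj; rewrite nt_nat !bK.
exists (NatTrans bn); split; apply: nat_trans_eq => X x /=; last exact: bK.
by apply: inj; rewrite bK.
Qed.

Lemma is_sheaf_iso (T : topology C) : nt_iso a -> is_sheaf T F -> is_sheaf T G.
Proof.
move=> /nt_isoP[b [aK bK]] shF X I U f fT; have [inj im] := shF X I U f fT.
split=> [y y' e|xi].
  apply: (can_inj (bK X)); apply: inj; apply: functional_extensionality_dep => i.
  by rewrite -!nt_nat; congr (b _ _); exact: (congr1 (fun h => h i) e).
have [im1 im2] := im (fun i => b _ (xi i)); split=> [[y <-] i j Q p1 p2 [e _]|e].
  by rewrite -!psh_comp e.
have [|x ex] := im2; first by move=> i j Q p1 p2 pb; rewrite -!nt_nat (e _ _ _ _ _ pb).
exists (a X x); apply: functional_extensionality_dep => i.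
by rewrite -nt_nat -[RHS]bK; congr (a _ _); exact: (congr1 (fun h => h i) ex).
Qed.

End NatIso.

Lemma nt_iso_comp (C : category) (F G H : presheaf C) (b : nat_trans G H)
  (a : nat_trans F G) : nt_iso b -> nt_iso a -> nt_iso (nt_comp b a).
Proof.
move=> /nt_isoP[b' [bK b'K]] /nt_isoP[a' [aK a'K]]; exists (nt_comp a' b').
by split; apply: nat_trans_eq => X x /=; rewrite ?bK ?aK ?a'K ?b'K.
Qed.

Lemma nt_iso_sym (C : category) (F G : presheaf C) (a : nat_trans F G) :
  nt_iso a -> exists b : nat_trans G F, nt_iso b.
Proof. by move=> [b [ba ab]]; exists b, a. Qed.

Lemma fp_pr2_iso (C : category) (F G H : presheaf C) (f : nat_trans F H)
  (g : nat_trans G H) : nt_iso f -> nt_iso (fp_pr2 f g).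
Proof.
move=> /nt_isoP[f' [fK f'K]]; apply: nt_iso_bij => X.
  move=> [[x y] /= e] [[x' y'] /= e'] /= ey; apply: fp_eq => /=; congr pair => //.
  by apply: (can_inj (fK X)); rewrite e e' ey.
by move=> y; exists (exist _ (f' X (g X y), y) (f'K X _)).
Qed.

Definition yon_el (C : category) (F : presheaf C) (X : C) (x : F X) :
  nat_trans (yoneda X) F :=
  @NatTrans C (yoneda X) F (fun T t => psh_map F t x)
    (fun S T u t => psh_comp t u x).

Lemma yonE (C : category) (F : presheaf C) (X : C) (a : nat_trans (yoneda X) F)
  (T : C) (t : hom T X) : a T t = psh_map F t (a X (idm X)).
Proof. by rewrite -nt_nat /= comp1m. Qed.

Lemma yon_arrowE (C : category) (Z X : C) (a : nat_trans (yoneda Z) (yoneda X))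
  (T : C) (t : hom T Z) : a T t = yon_arrow a ∘ t.
Proof. exact: yonE. Qed.

Lemma yon_arrow_iso (C : category) (Z X : C) (a : nat_trans (yoneda Z) (yoneda X)) :
  nt_iso a -> is_iso (yon_arrow a).
Proof.
move=> /nt_isoP[b [aK bK]]; exists (yon_arrow b).
by rewrite -!yon_arrowE; split; [exact: aK | exact: bK].
Qed.

(** By Yoneda, elements of [F X] are transformations from [yoneda X] to [F], and a monomorphism can
    be cancelled from these. *)
Lemma is_mono_inj (C : category) (F G : presheaf C) (f : nat_trans F G) (X : C) :
  is_mono f -> injective (f X).
Proof.
move=> fm x y e.
have /(congr1 (fun c : nat_trans (yoneda X) F => c X (idm X))) :
    yon_el x = yon_el y.
  by apply: fm; apply: nat_trans_eq => T t /=; rewrite !nt_nat e.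
by rewrite /= !psh_id.
Qed.

(** * Representable functors are sheaves and have an open covering *)

Section Site.
Variables (P : SSpaces -> Prop) (T : topology (full P)).
Hypothesis siteT : superspace_site T.

Definition full_open (X : full P) (U : opens (sval X)) : full P :=
  exist _ (open_sub U : SSpaces) (site_open siteT (svalP X) U).

Definition full_incl (X : full P) (U : opens (sval X)) : hom (full_open U) X :=
  open_incl U.

Lemma yoneda_sheaf (Y : full P) : is_sheaf T (yoneda Y).
Proof.
move=> X I U f fT.
have fE := site_cov_emb siteT fT; have fcov := site_cov_surj siteT fT.
split=> [a b e|xi].
  by apply: (hom_separated fE fcov) => i; exact: (congr1 (fun h => h i) e).
split=> [[a <-] i j Q p1 p2 [e _]|compat].
  exact (etrans (esym (compA _ _ _)) (etrans (congr1 (comp a) e) (compA _ _ _))).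
have [|a aE] := hom_glue fE fcov (xi := xi).
  move=> i j N p1 p2 e.
  (* The open subsuperspace on [N] is an object of the site, so [p1] and [p2] factor through the
     fibered product [R], where [compat] gives the agreement. *)
  have [R [r1 [r2 pb]]] := Cov_pullback_ex (f j) fT i.
  have [u [[<- <-] _]] := pb.2 (full_open N) p1 p2 e.
  have e' := congr1 (fun h : hom R Y => h ∘ u) (compat i j R r1 r2 pb).
  exact (etrans (sshom_compA _ _ _) (etrans e' (esym (sshom_compA _ _ _)))).
by exists a; apply: functional_extensionality_dep.
Qed.

(** The isomorphism from [yoneda X] to [F] is by itself a covering: its base changes are
    isomorphisms, hence surjective open embeddings. *)
Lemma representable_covering (F : presheaf (full P)) :
  representable F -> has_open_covering_by_representables T F.
Proof.
move=> [X [a aI]]; exists unit, (fun=> yoneda X), (fun=> a).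
have pI Y (g : nat_trans (yoneda Y) F) (Z : full P)
    (c : nat_trans (yoneda Z) (fib_prod a g)) : nt_iso c ->
    is_iso (yon_arrow (nt_comp (fp_pr2 a g) c)).
  by move=> cI; apply: yon_arrow_iso; apply: nt_iso_comp => //; exact: fp_pr2_iso.
have pE Y (g : nat_trans (yoneda Y) F) (Z : full P)
    (c : nat_trans (yoneda Z) (fib_prod a g)) : nt_iso c ->
    open_embedding (Y := sval Z) (X := sval Y) (yon_arrow (nt_comp (fp_pr2 a g) c)).
  by move=> cI; apply: iso_open_embedding; exact: (pI _ _ _ _ cI).
split; last by move=> _; exists X, (nt_id _), (nt_id _); split; exact: nat_trans_eq.
split=> [_|Y g Z c cI].
  split=> [H b b' e|Y g|Y g Z c]; last exact: pE.
    have [a' [aK _]] := nt_isoP aI; apply: nat_trans_eq => Y y.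
    apply: (can_inj (aK Y)); exact: (congr1 (fun c : nat_trans H F => c Y y) e).
  by have [b bI] := nt_iso_sym (fp_pr2_iso g aI); exists Y, b.
apply: (site_cov_all siteT) => [i|]; first exact: pE.
apply/seteqP; split=> // y _; exists tt => //.
have [h [_ hK]] := pI _ _ _ _ (cI tt).
exists ((h : sshom (sval Y) (sval (Z tt))) y) => //.
exact: (congr1 (fun u : sshom (sval Y) (sval Y) => u y) hK).
Qed.

Lemma full_incl_cov (X : full P) (I : Type) (W : I -> opens (sval X)) :
  (forall p, exists i, oset (W i) p) -> Cov T (fun i => full_incl (W i)).
Proof.
move=> cov; apply: (site_cov_all siteT) => [i|].
  exists (W i), (idm _); split; last exact: esym (compm1 _).
  by exists (idm _); split; exact: comp1m.
apply/seteqP; split=> // p _; have [i Wp] := cov p.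
by exists i => //; exists (sub_pt Wp).
Qed.

(** * From open coverings by representables to atlases of elements *)

Definition lands_in (S Y : full P) (t : hom S Y) (W : opens (sval Y)) : Prop :=
  forall p, oset W ((t : sshom (sval S) (sval Y)) p).

(** For an atlas, this says that the open subsuperspace on [W i] represents the fibered product of
    [yoneda (X i)] and [yoneda Y] over [F], since the [s] attached to [t] is unique. *)
Definition chart_domains (F : presheaf (full P)) (I : Type) (X : I -> full P)
  (u : forall i, F (X i)) (Y : full P) (y : F Y) (W : I -> opens (sval Y)) : Prop :=
  forall i (S : full P) (t : hom S Y),
    lands_in t (W i) <-> exists s : hom S (X i), psh_map F s (u i) = psh_map F t y.

Definition is_atlas (F : presheaf (full P)) (I : Type) (X : I -> full P)
  (u : forall i, F (X i)) : Prop :=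
  (forall i (S : full P), injective (fun s : hom S (X i) => psh_map F s (u i))) /\
  forall (Y : full P) (y : F Y), exists W : I -> opens (sval Y),
    (forall p, exists i, oset (W i) p) /\ chart_domains u y W.

(** The element [u i] is the Yoneda image of the i-th map of the covering. For [y] in [F Y], the
    fibered product of [U i] with [yoneda Y] is represented by some [Z i] openly embedded in [Y],
    and [W i] is the image of this embedding. *)
Lemma covering_atlas (F : presheaf (full P)) :
  has_open_covering_by_representables T F ->
  exists (I : Type) (X : I -> full P) (u : forall i, F (X i)), is_atlas u.
Proof.
move=> [I [U [f [[fO fC] Urep]]]].
pose X i := projT1 (cid (Urep i)).
pose al i : nat_trans (yoneda (X i)) (U i) := projT1 (cid (projT2 (cid (Urep i)))).
have alI i : nt_iso (al i) := projT2 (cid (projT2 (cid (Urep i)))).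
pose u i : F (X i) := f i _ (al i _ (idm _)).
have uE i S (s : hom S (X i)) : psh_map F s (u i) = f i _ (al i _ s).
  by rewrite -nt_nat -yonE.
exists I, X, u; split=> [i S s s'|Y y].
  rewrite !uE; have [fm _ _] := fO i => /(is_mono_inj fm).
  by have [b [aK _]] := nt_isoP (alI i) => /(can_inj (aK S)).
pose g := yon_el y.
have Zex i : exists Z : full P, exists a : nat_trans (yoneda Z) (fib_prod (f i) g), nt_iso a.
  by have [_ fr _] := fO i; exact: fr.
pose Z i := projT1 (cid (Zex i)).
pose a i : nat_trans (yoneda (Z i)) (fib_prod (f i) g) := projT1 (cid (projT2 (cid (Zex i)))).
have aI i : nt_iso (a i) := projT2 (cid (projT2 (cid (Zex i)))).
pose e i : hom (Z i) Y := yon_arrow (nt_comp (fp_pr2 (f i) g) (a i)).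
have eE i : open_embedding (Y := sval (Z i)) (X := sval Y) (e i).
  by have [_ _ fe] := fO i; exact: (fe _ _ _ _ (aI i)).
have aE i S (r : hom S (Z i)) : (sval (a i S r)).2 = e i ∘ r.
  exact: (yon_arrowE (nt_comp (fp_pr2 (f i) g) (a i)) r).
have [W WE] := choice (fun i => open_embedding_open (eE i)).
exists W; split=> [p|i S t].
  have [i _ ip] : (\bigcup_i range (base (e i : sshom (sval (Z i)) (sval Y)))) p.
    by rewrite (site_cov_surj siteT (fC Y g Z a aI)).
  by exists i; rewrite WE.
have [b [aK bK]] := nt_isoP (aI i); have [b' [alK b'K]] := nt_isoP (alI i).
split=> [tW|[s es]].
  have [r er] : exists r : hom S (Z i), e i ∘ r = t.
    by apply: (open_embedding_lift (eE i)) => _ [p _ <-]; rewrite -WE; exact: tW.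
  exists (b' S (sval (a i S r)).1); rewrite uE b'K (svalP (a i S r)) /=.
  by rewrite aE er.
(* The pair made of [s] and [t] is an element of the fibered product, hence comes from a morphism to
   [Z i]; so [t] factors through [e i]. *)
have et : f i S (al i S s, t).1 = g S (al i S s, t).2 by rewrite /= -uE.
have := aE i S (b S (exist _ (al i S s, t) et)); rewrite bK /= => -> p.
by rewrite WE; eexists.
Qed.

(** * Gluing the charts of an atlas into a representing object *)

Section Glue.
Variables (F : presheaf (full P)) (shF : is_sheaf T F).
Variables (I : Type) (X : I -> full P) (u : forall i, F (X i)).
Hypothesis atlas : is_atlas u.

Lemma chart_inj i (S : full P) (s s' : hom S (X i)) :
  psh_map F s (u i) = psh_map F s' (u i) -> s = s'.
Proof. by case: atlas => inj _; exact: inj. Qed.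

(** This is U_ij: the part of [X i] on which [u i] is also a pullback of [u j]. *)
Let dom i : I -> opens (sval (X i)) :=
  projT1 (cid ((proj2 atlas) (X i) (u i))).

Lemma domP i j (S : full P) (t : hom S (X i)) :
  lands_in t (dom i j) <-> exists s : hom S (X j), psh_map F s (u j) = psh_map F t (u i).
Proof. exact: (projT2 (cid ((proj2 atlas) (X i) (u i)))).2. Qed.

Let dsub i j : full P := full_open (dom i j).
Let dincl i j : hom (dsub i j) (X i) := full_incl (dom i j).

Lemma full_corestr (S Y : full P) (t : hom S Y) (W : opens (sval Y)) :
  lands_in t W -> exists s : hom S (full_open W), full_incl W ∘ s = t.
Proof. by move=> tW; exists (corestr tW); exact: corestrE. Qed.

Lemma full_incl_mono (S Y : full P) (W : opens (sval Y)) (s s' : hom S (full_open W)) :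
  full_incl W ∘ s = full_incl W ∘ s' -> s = s'.
Proof. exact: open_incl_mono. Qed.

Lemma transition_ex i j : exists phi : hom (dsub i j) (dsub j i),
  psh_map F (dincl j i ∘ phi) (u j) = psh_map F (dincl i j) (u i).
Proof.
have [s es] : exists s : hom (dsub i j) (X j), psh_map F s (u j) = psh_map F (dincl i j) (u i).
  by apply/domP => p; exact: set_valP.
have [|phi ephi] := @full_corestr _ _ s (dom j i); last by exists phi; rewrite ephi.
(* The equation [es], read from right to left, says that the pullback of [u j] along [s] comes from
   [u i] through the inclusion of U_ij; hence [s] lands in U_ji. *)
by apply/domP; exists (dincl i j).
Qed.

Definition transition i j : hom (dsub i j) (dsub j i) := projT1 (cid (transition_ex i j)).

Lemma transitionE i j S (a : hom S (dsub i j)) :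
  psh_map F (dincl j i ∘ (transition i j ∘ a)) (u j) = psh_map F (dincl i j ∘ a) (u i).
Proof.
rewrite compA psh_comp [psh_map F (dincl j i ∘ _) _](projT2 (cid (transition_ex i j))).
by rewrite psh_comp.
Qed.

Lemma transition_uniq i j S (a : hom S (dsub i j)) (s : hom S (X j)) :
  psh_map F s (u j) = psh_map F (dincl i j ∘ a) (u i) ->
  s = dincl j i ∘ (transition i j ∘ a).
Proof. by rewrite -transitionE; exact: chart_inj. Qed.

Lemma transitionK i j : transition j i ∘ transition i j = idm (dsub i j).
Proof.
apply: full_incl_mono; apply: chart_inj.
(* An identity is inserted so that [transitionE] applies a second time. *)
rewrite transitionE -[transition i j]compm1 transitionE //.
Qed.

Lemma transition_iso i j : is_iso (transition i j : hom (sval (dsub i j)) (sval (dsub j i))).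
Proof. by exists (transition j i); split; exact: transitionK. Qed.

Lemma dom_refl i x : oset (dom i i) x.
Proof.
have : lands_in (idm (X i)) (dom i i) by apply/domP; exists (idm (X i)).
by move/(_ x).
Qed.

(** The map phi_ji sends the intersection of U_ij and U_ik into U_jk: the pullback of [u j] along it
    is the restriction of [u i], which comes from [u k] through phi_ki. Both routes to [X k] then
    pull [u k] back to this restriction, so they coincide. *)
Lemma transition_cocycle i j k :
  let W := opensI (dom i j) (dom i k) in
  exists (a : hom (full_open W) (dsub i j)) (b : hom (full_open W) (dsub i k))
    (c : hom (full_open W) (dsub j k)),
    [/\ dincl i j ∘ a = full_incl W, dincl i k ∘ b = full_incl W,
        dincl j k ∘ c = dincl j i ∘ (transition i j ∘ a) &
        dincl k i ∘ (transition i k ∘ b) = dincl k j ∘ (transition j k ∘ c)].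
Proof.
move=> W.
have [|a ea] := @full_corestr _ _ (full_incl W) (dom i j).
  by move=> p; have [] := set_valP p.
have [|b eb] := @full_corestr _ _ (full_incl W) (dom i k).
  by move=> p; have [] := set_valP p.
have [|c ec] := @full_corestr _ _ (dincl j i ∘ (transition i j ∘ a)) (dom j k).
  apply/domP; exists (dincl k i ∘ (transition i k ∘ b)).
  by rewrite !transitionE; congr (psh_map F _ _); exact: etrans eb (esym ea).
exists a, b, c; split=> //; apply: transition_uniq.
rewrite [X in _ = psh_map F X _]ec !transitionE.
by congr (psh_map F _ _); exact: etrans eb (esym ea).
Qed.

Definition atlas_gluing : gluing_datum :=
  @GluingDatum I (fun i => sval (X i)) dom dom_refl transition transition_iso
    transition_cocycle.

Lemma atlas_representable : representable F.
Proof.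
have [X0 [phi0 [gl PX0]]] := site_glue siteT (D := atlas_gluing) (fun i => svalP (X i)).
pose Z : full P := exist _ X0 PX0.
pose phi i : hom (X i) Z := phi0 i.
have phiE i : open_embedding (Y := sval (X i)) (X := X0) (phi i) by exact: gluing_emb gl i.
have phiC i j S (a : hom S (dsub i j)) :
    phi i ∘ (dincl i j ∘ a) = phi j ∘ (dincl j i ∘ (transition i j ∘ a)).
  rewrite !compA; congr (_ ∘ a); rewrite -[RHS]compA; exact: gluing_compat gl i j.
(* This allows the sheaf property of [F] to be applied to the charts of the glued superspace. *)
have phicov : Cov T phi.
  apply: (site_cov_all siteT) => //; apply/seteqP; split=> // x _.
  by have [i [y <-]] := gluing_cover gl x; exists i => //; exists y.
have phi_mono i S (a b : hom S (X i)) : phi i ∘ a = phi i ∘ b -> a = b.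
  exact: (open_embedding_mono (phiE i)).
(* The image of U_ij is the whole intersection of the two chart images, so [p1] lands in U_ij. Since
   [phi j] is monic, [p2] is then its transition, and the pullbacks of [u i] and [u j] agree. *)
have meet i j S (p1 : hom S (X i)) (p2 : hom S (X j)) :
    phi i ∘ p1 = phi j ∘ p2 -> psh_map F p1 (u i) = psh_map F p2 (u j).
  move=> e.
  have [|a ea] := @full_corestr _ _ p1 (dom i j).
    move=> q; have [e1 e2] := gluing_meet gl i j.
    have : (range (base (phi0 i : sshom _ X0)) `&` range (base (phi0 j : sshom _ X0)))
        (phi0 i ((p1 : sshom (sval S) (sval (X i))) q)).
      split; first by eexists.
      exists ((p2 : sshom (sval S) (sval (X j))) q) => //.
      exact: esym (congr1 (fun h : sshom (sval S) X0 => h q) e).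
    by rewrite -e2 -e1 => -[r Wr /(open_embedding_inj (phiE i)) <-].
  move: e; rewrite -ea phiC => /phi_mono <-.
  by rewrite transitionE.
have [x0 ex0] : exists x : F Z, (fun i => psh_map F (phi i) x) = u.
  apply/(shF phicov).2 => i j Q p1 p2 [e _]; exact: meet e.
have ex i : psh_map F (phi i) x0 = u i by exact: (congr1 (fun h => h i) ex0).
have inj S : injective (yon_el x0 S).
  move=> t t' /= e.
  have [O OE] := choice (fun i => open_embedding_open (phiE i)).
  have Ocov z : exists i, oset (O i) z.
    by have [i [y <-]] := gluing_cover gl z; exists i; rewrite OE; exists y.
  (* A point may be sent by [t] and [t'] into different charts, so the cover of [S] is indexed by
     pairs. On each member the lifts [s] and [s'] pull [u i] and [u j] back to the same element,
     hence differ by a transition, which [phi] absorbs. *)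
  pose N (ij : I * I) : opens (sval S) :=
    opensI (spreim (t : sshom (sval S) X0) (O ij.1))
           (spreim (t' : sshom (sval S) X0) (O ij.2)).
  apply: (@sshom_separated (sval S) X0 (I * I) N) => [p|[i j]].
    have [i Oi] := Ocov ((t : sshom (sval S) X0) p).
    by have [j Oj] := Ocov ((t' : sshom (sval S) X0) p); exists (i, j).
  pose v := full_incl (N (i, j)).
  have [s es] : exists s : hom (full_open (N (i, j))) (X i), phi i ∘ s = t ∘ v.
    apply: (open_embedding_lift (phiE i)) => _ [q _ <-]; rewrite -OE.
    by have [] := set_valP q.
  have [s' es'] : exists s' : hom (full_open (N (i, j))) (X j), phi j ∘ s' = t' ∘ v.
    apply: (open_embedding_lift (phiE j)) => _ [q _ <-]; rewrite -OE.
    by have [] := set_valP q.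
  have us : psh_map F s' (u j) = psh_map F s (u i).
    by rewrite -!ex -!psh_comp es es' !psh_comp e.
  have [a ea] : exists a, dincl i j ∘ a = s.
    by apply: full_corestr; apply/domP; exists s'.
  move: us; rewrite -ea => /transition_uniq es''.
  rewrite -[LHS]/(t ∘ v) -[RHS]/(t' ∘ v) -es -es' -ea es''; exact (phiC i j _ a).
exists Z, (yon_el x0); apply: nt_iso_bij => // S y.
(* Surjectivity: on [W i] the element [y] is the pullback of [u i] along some [s i]. The morphisms
   [phi i ∘ s i] pull [x0] back to restrictions of [y], so they agree on overlaps by [inj] and
   glue. *)
have [W [Wcov WP]] := (proj2 atlas) S y.
have Wfull : Cov T (fun i => full_incl (W i)) by exact: full_incl_cov.
have sex i : exists s : hom (full_open (W i)) (X i),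
    psh_map F s (u i) = psh_map F (full_incl (W i)) y.
  by apply/WP => p; exact: set_valP.
pose s i := projT1 (cid (sex i)).
have sE i : psh_map F (s i) (u i) = psh_map F (full_incl (W i)) y := projT2 (cid (sex i)).
have [t tE] : exists t : hom S Z, (fun i => t ∘ full_incl (W i)) = (fun i => phi i ∘ s i).
  apply/(yoneda_sheaf Z Wfull).2 => i j Q p1 p2 [e _]; apply: inj.
  rewrite -[LHS]/(psh_map F (phi i ∘ s i ∘ p1) x0).
  rewrite -[RHS]/(psh_map F (phi j ∘ s j ∘ p2) x0).
  by rewrite !psh_comp !ex !sE -!psh_comp e.
exists t; apply: (shF Wfull).1; apply: functional_extensionality_dep => i /=.
have ti : t ∘ full_incl (W i) = phi i ∘ s i by exact: (congr1 (fun h => h i) tE).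
by rewrite -psh_comp ti psh_comp ex sE.
Qed.

End Glue.

End Site.

Theorem theorem4p8 (P : SSpaces -> Prop) (T : topology (full P))
  (siteT : superspace_site T) (F : presheaf (full P)) :
  representable F <-> is_sheaf T F /\ has_open_covering_by_representables T F.
Proof.
split=> [Frep|[Fsh /(covering_atlas siteT)[I [X [u atlas]]]]].
  split; last exact: representable_covering.
  by have [X [a aI]] := Frep; apply: (is_sheaf_iso aI); exact: yoneda_sheaf.
exact: (atlas_representable siteT Fsh atlas).
Qed.
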